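(* Assume condition (A1) (stated in the context). Let $f\in C^1(\mathbb{R})$ satisfy $$\inf_{|r|\ge1}f'(r)>0,$$ and let $u\in C_b(\mathbb{R}^d)$ solve, in the viscosity sense, $$Lu(x)=f(u(x))\ \text{ for } x\in\mathbb{R}^d,\qquad \lim_{x_d\to\pm\infty}u(x',x_d)=\pm1\ \text{ uniformly for } x'\in\mathbb{R}^{d-1}.$$ Then there exists a strictly increasing function $u_0:\mathbb{R}\to\mathbb{R}$ satisfying $$u(y,t)=u_0(t)\quad\text{for all } y\in\mathbb{R}^{d-1},\ t\in\mathbb{R}.$$
   Context: Operator: $j:\mathbb{R}^d\setminus\{0\}\to[0,\infty)$ is a fixed measurable function with $\int_{\mathbb{R}^d}(1\wedge|y|^2)j(y)\,dy<\infty$, and $$Lu(x)=\Delta u(x)+\int_{\mathbb{R}^d}\big(u(x+y)-u(x)-\mathbf 1_{\{|y|\le1\}}\,y\cdot\nabla u(x)\big)j(y)\,dy.$$ Exponent and condition (A1): $\psi(z)=\int_{\mathbb{R}^d}(1-e^{iz\cdot\xi}+\mathbf 1_{\{|\xi|\le1\}}\,iz\cdot\xi)\,j(\xi)\,d\xi$. Condition (A1): for some constant $C>0$, $|\mathrm{Im}\,\psi(p)|\le C(|p|^2+|\mathrm{Re}\,\psi(p)|)$ for all $p\in\mathbb{R}^d$, and for all $r>0$, $\sup_{|p|\le r}(|p|^2+\mathrm{Re}\,\psi(p))>0$. Viscosity solutions (in a domain $D$, here $D=\mathbb{R}^d$): functions are Borel measurable. A bounded $u:\mathbb{R}^d\to\mathbb{R}$,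 upper (lower) semicontinuous in $\bar D$, is a viscosity subsolution (supersolution) of $Lu=h$ in $D$, written $Lu\ge h$ ($Lu\le h$), if for every $x\in D$, every neighbourhood $N_x$ of $x$ in $D$ and every $\varphi\in C^2(\overline{N_x})$ such that $\varphi-u$ attains minimum (maximum) $0$ in $N_x$ at $x$, the function $v$ equal to $\varphi$ in $N_x$ and to $u$ elsewhere satisfies $Lv(x)\ge h(x)$ ($Lv(x)\le h(x)$). A viscosity solution is both. Here $h(x)=f(u(x))$. Points of $\mathbb{R}^d$ are written $x=(x',x_d)$ with $x'\in\mathbb{R}^{d-1}$; $C_b$: bounded continuous functions. *)

(* Defs.v *)
From HB Require Import structures.
From mathcomp Require Import all_boot all_order all_algebra.
From mathcomp Require Import all_classical all_reals all_analysis.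
From mathcomp Require Import measurable_realfun complex.

Set Implicit Arguments.
Unset Strict Implicit.
Unset Printing Implicit Defensive.

Import Order.TTheory GRing.Theory Num.Theory.
Import numFieldNormedType.Exports.

Local Open Scope classical_set_scope.
Local Open Scope ring_scope.

(* R^n is 'rV[R]_n, with its Borel sigma-algebra. *)
HB.instance Definition _ (R : realType) (n : nat) :=
  @isMeasurable.Build (sigma_display (@open 'rV[R]_n)) 'rV[R]_n
    <<s @open 'rV[R]_n >> (@sigma_algebra0 _ setT (@open 'rV[R]_n))
    (@sigma_algebraC _ (@open 'rV[R]_n))
    (@sigma_algebra_bigcup _ setT (@open 'rV[R]_n)).

(* The point (y, t) of R^(n+1) = R^n x R; its last coordinate is t. *)
Definition rV_rcons (R : realType) (n : nat) (y : 'rV[R]_n) (t : R) :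
    'rV[R]_n.+1 :=
  \row_i oapp (y 0) t (unlift ord_max i).

Section lebesgue_rV.
Variable R : realType.

Lemma open_measurable_rV n (A : set 'rV[R]_n) : open A -> measurable A.
Proof. by move=> oA; exact: sub_sigma_algebra. Qed.

Lemma continuous_measurable_rV n (f : 'rV[R]_n -> R) :
  continuous f -> measurable_fun [set: 'rV[R]_n] f.
Proof.
move=> /continuousP cf.
apply: (measurability _ (RGenOpens.measurableE R)).
move=> _ [_ [a [b ->] <-]]; rewrite setTI; apply: open_measurable_rV.
exact/cf/interval_open.
Qed.

Lemma rV_rcons_lift n (y : 'rV[R]_n) t i :
  rV_rcons y t 0 (lift ord_max i) = y 0 i.
Proof. by rewrite mxE liftK. Qed.

Lemma rV_rcons_max n (y : 'rV[R]_n) t : rV_rcons y t 0 ord_max = t.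
Proof. by rewrite mxE unlift_none. Qed.

Definition rV_unrcons n (x : 'rV[R]_n.+1) : 'rV[R]_n * R :=
  (\row_i x 0 (lift ord_max i), x 0 ord_max).

Lemma rV_rconsK n (p : 'rV[R]_n * R) : rV_unrcons (rV_rcons p.1 p.2) = p.
Proof.
case: p => y t; rewrite /rV_unrcons rV_rcons_max; congr pair.
by apply/rowP => i; rewrite mxE rV_rcons_lift.
Qed.

Lemma rV_unrconsK n (x : 'rV[R]_n.+1) :
  rV_rcons (rV_unrcons x).1 (rV_unrcons x).2 = x.
Proof.
apply/rowP => i; case: (unliftP ord_max i) => [k|] ->.
  by rewrite rV_rcons_lift mxE.
by rewrite rV_rcons_max.
Qed.

Lemma measurable_rV_unrcons n :
  measurable_fun [set: 'rV[R]_n.+1]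
    (@rV_unrcons n : _ -> 'rV[R]_n * measurableTypeR R).
Proof.
apply: measurable_fun_pair; last first.
  exact: continuous_measurable_rV (@coord_continuous _ _ _ _ _).
apply: (measurability _ (erefl (<<s @open 'rV[R]_n >>))).
move=> _ [B oB <-]; rewrite setTI; apply: open_measurable_rV.
apply: (proj1 (continuousP _)) B oB => x A /= [P nP PA].
exists (fun i k => if unlift ord_max k is Some k' then P 0 k' else setT).
  move=> i k; case: (unliftP ord_max k) => [k'|] ->;
    rewrite ?liftK ?unlift_none.
    by have := nP 0 k'; rewrite !mxE ord1.
  exact: filterT.
move=> y Py; apply: PA => i k; rewrite mxE.
by have := Py 0 (lift ord_max k); rewrite liftK ord1.
Qed.

Lemma open_subball_rat_rV n (A : set 'rV[R]_n) x : open A -> A x ->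
  exists qr : 'rV[rat]_n * rat,
    let B := ball (map_mx ratr qr.1 : 'rV[R]_n) (ratr qr.2 : R) in
    B x /\ B `<=` A.
Proof.
move=> oA Ax.
have : nbhs x A by exact: (open_nbhs_nbhs (conj oA Ax)).
rewrite -nbhs_ballE => -[e /= e0 eA].
have [r /andP[r0 re]] : exists r : rat, 0 < (ratr r : R) < e / 2.
  have e20 : 0 < e / 2 by rewrite divr_gt0.
  have [r] := @rat_in_itvoo R 0 (e / 2) e20.
  by rewrite in_itv/= => rP; exists r.
have /choice[q qP] (i : 'I_n) : exists q : rat, `|x 0 i - ratr q| < ratr r :> R.
  have xr : x 0 i - ratr r < x 0 i + ratr r.
    by rewrite ltrBlDr -addrA ltrDl addr_gt0.
  have [q] := rat_in_itvoo xr.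
  rewrite in_itv/= => qP; exists q; rewrite distrC ltr_distl.
  exact: qP.
exists (\row_i q i, r) => /=; split.
  split => // i k; rewrite ord1 !mxE /ball/= distrC; exact: qP.
apply: subset_trans eA => y [_ yP]; split => // i k.
rewrite ord1; have := yP 0 k; rewrite !mxE /ball/= => yk.
rewrite -(subrK (ratr (q k)) (x 0 k)) -addrA.
rewrite (le_lt_trans (ler_normD _ _))// (splitr e) ltrD//.
  exact: lt_trans (qP k) re.
exact: lt_trans yk re.
Qed.

Lemma measurable_rV_rcons n :
  measurable_fun [set: 'rV[R]_n * measurableTypeR R]
    (fun p => rV_rcons p.1 p.2).
Proof.
apply: (measurability _ (erefl (<<s @open 'rV[R]_n.+1 >>))).
move=> _ [A oA <-]; rewrite setTI.
pose B (qr : 'rV[rat]_n.+1 * rat) : set 'rV[R]_n.+1 :=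
  ball (map_mx ratr qr.1 : 'rV[R]_n.+1) (ratr qr.2 : R).
have -> : (fun p : 'rV[R]_n * R => rV_rcons p.1 p.2) @^-1` A =
    \bigcup_qr (if `[< B qr `<=` A >] then
      (fun p : 'rV[R]_n * R => rV_rcons p.1 p.2) @^-1` B qr else set0).
  apply/seteqP; split => [p /= Ap|p [qr _]].
    have [qr [Bp BA]] := open_subball_rat_rV oA Ap.
    by exists qr => //; case: asboolP.
  by case: asboolP => // BA Bp; exact: BA.
apply: countable_bigcupT_measurable => // -[q r].
case: asboolP => // _; have [r0|r0] := leP (ratr r : R) 0.
  rewrite [X in measurable X](_ : _ = set0)//.
  by apply/seteqP; split => // p [/(le_lt_trans r0)]; rewrite ltxx.
rewrite [X in measurable X](_ : _ =
    ball (\row_i ratr (q 0 (lift ord_max i)) : 'rV[R]_n) (ratr r : R) `*`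
    ball (ratr (q 0 ord_max) : R) (ratr r : R)); last first.
  apply/seteqP; split => [[y t] [_ /= yt]|[y t] [/= [_ yr] tr]].
    split => /=.
      split => // i k; rewrite ord1 mxE.
      by have := yt 0 (lift ord_max k); rewrite rV_rcons_lift mxE.
    by have := yt 0 ord_max; rewrite rV_rcons_max mxE.
  split => // i k; rewrite ord1; case: (unliftP ord_max k) => [k'|] ->.
    by have := yr 0 k'; rewrite rV_rcons_lift !mxE.
  by rewrite rV_rcons_max mxE.
apply: measurableX; last by apply: open_measurable; exact: ball_open.
by apply: open_measurable_rV; exact: ball_open.
Qed.


Section lebesgue_rVS.
Local Open Scope ereal_scope.
Variables (n : nat) (m : {sigma_finite_measure set 'rV[R]_n -> \bar R}).

Let leb : {sigma_finite_measure set (measurableTypeR R) -> \bar R} :=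
  @lebesgue_measure R.

Definition lebesgue_rVS : set 'rV[R]_n.+1 -> \bar R :=
  pushforward (m \x leb) (fun p => rV_rcons p.1 p.2).

HB.instance Definition _ := Measure.copy lebesgue_rVS
  (measure_function_pushforward__canonical__measure_function_Measure
     (m \x leb) (@measurable_rV_rcons n)).

Let lebesgue_rVS_sigma_finite : sigma_finite setT lebesgue_rVS.
Proof.
have /sigma_finiteP[F [FT ndF Foo]] := sigma_finiteT m.
have /sigma_finiteP[G [GT ndG Goo]] := sigma_finiteT leb.
exists (fun k => @rV_unrcons n @^-1` (F k `*` G k)).
  apply/seteqP; split => // x _.
  have [k _ Fk] : (\bigcup_k F k) (rV_unrcons x).1 by rewrite -FT.
  have [l _ Gl] : (\bigcup_k G k) (rV_unrcons x).2 by rewrite -GT.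
  exists (maxn k l) => //; split.
    by move: Fk; exact/subsetPset/ndF/leq_maxl.
  by move: Gl; exact/subsetPset/ndG/leq_maxr.
move=> k; have [mF Fk] := Foo k; have [mG Gk] := Goo k; split.
  rewrite -[X in measurable X]setTI; apply: measurable_rV_unrcons => //.
  exact: measurableX.
rewrite /lebesgue_rVS /pushforward (_ : _ @^-1` _ = F k `*` G k).
  by rewrite product_measure1E// lte_mul_pinfty// ge0_fin_numE.
by apply/funext => p; rewrite /preimage /mkset rV_rconsK.
Qed.

HB.instance Definition _ :=
  Measure_isSigmaFinite.Build _ _ _ lebesgue_rVS lebesgue_rVS_sigma_finite.

End lebesgue_rVS.

Fixpoint lebesgue_rV n : {sigma_finite_measure set 'rV[R]_n -> \bar R} :=
  if n is n'.+1 then lebesgue_rVS (lebesgue_rV n')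
  else \d_(0 : 'rV[R]_0).

Lemma lebesgue_rV_box n (A : 'I_n -> set (measurableTypeR R)) :
  (forall i, measurable (A i)) ->
  lebesgue_rV n [set x | forall i, A i (x 0 i)] =
  (\prod_(i < n) lebesgue_measure (A i))%E.
Proof.
elim: n A => [|n IHn] A mA.
  by rewrite big_ord0/= diracE mem_set// => -[].
have mB k (B : 'I_k -> set (measurableTypeR R)) :
    (forall i, measurable (B i)) ->
    measurable [set x : 'rV[R]_k | forall i, B i (x 0 i)].
  move=> mB; rewrite (_ : mkset _ =
      \bigcap_(i in [set: 'I_k]) ((fun x : 'rV[R]_k => x 0 i) @^-1` B i)).
    apply: fin_bigcap_measurable => // i _.
    have mi : measurable_fun [set: 'rV[R]_k]
        (fun x : 'rV[R]_k => x 0 i : measurableTypeR R).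
      exact: continuous_measurable_rV (@coord_continuous _ _ _ _ _).
    by rewrite -[X in measurable X]setTI; exact: mi.
  by apply/seteqP; split => [x Bx i _|x Bx i]; exact: Bx.
have liftE (i : 'I_n) : widen_ord (leqnSn n) i = lift ord_max i.
  by apply: val_inj; rewrite /= /bump leqNgt ltn_ord.
have E : (fun p => rV_rcons p.1 p.2) @^-1` [set x | forall i, A i (x 0 i)] =
    [set y : 'rV[R]_n | forall i, A (widen_ord (leqnSn n) i) (y 0 i)] `*`
    (A ord_max : set (measurableTypeR R)).
  apply/seteqP; split => -[y t] /=.
    move=> Ayt; split => [i|].
      by rewrite liftE; have := Ayt (lift ord_max i); rewrite rV_rcons_lift.
    by have := Ayt ord_max; rewrite rV_rcons_max.
  move=> [Ay At] i; case: (unliftP ord_max i) => [k|] ->.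
    by rewrite rV_rcons_lift -liftE.
  by rewrite rV_rcons_max.
rewrite big_ord_recr/= /lebesgue_rVS /pushforward E product_measure1E//.
  by congr (_ * _)%E; exact: IHn.
exact: (mB _ (fun i => A (widen_ord (leqnSn n) i))).
Qed.

End lebesgue_rV.

Section operator.
Variables (R : realType) (n : nat).
Implicit Types (x y z p : 'rV[R]_n) (u v phi h : 'rV[R]_n -> R).
Implicit Types (j : 'rV[R]_n -> R) (D N : set 'rV[R]_n).

Definition dotv x y : R := \sum_(i < n) x 0 i * y 0 i.

(* The library norm on 'rV[R]_n is the sup norm, hence the Euclidean norm. *)
Definition enorm x : R := Num.sqrt (dotv x x).

Definition grad u x : 'rV[R]_n := \row_i 'D_(delta_mx 0 i) u x.

Definition laplacian u x : R :=
  \sum_(i < n) 'D_(delta_mx 0 i) (fun y => 'D_(delta_mx 0 i) u y) x.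

Definition punctured : set 'rV[R]_n := [set y | y != 0].

Definition levy_density j : Prop :=
  [/\ forall y, y != 0 -> 0 <= j y,
      measurable_fun punctured j &
      (\int[lebesgue_rV R n]_(y in punctured)
         (Num.min 1 (enorm y ^+ 2) * j y)%:E < +oo)%E].

(* L u x is extended-real-valued: in the definition of viscosity solutions the
   test function may be unbounded, so that the integral may be +oo (subsolution
   test) or -oo (supersolution test). *)
Definition levy_op j u x : \bar R :=
  ((laplacian u x)%:E +
   \int[lebesgue_rV R n]_(y in punctured)
     ((u (x + y)%R - u x - \1_[set z | enorm z <= 1] y * dotv y (grad u x))
      * j y)%:E)%E.

Definition expi (t : R) : R[i] := (cos t +i* sin t)%C.

Definition complex_integral (D : set 'rV[R]_n) (F : 'rV[R]_n -> R[i]) : R[i] :=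
  (Rintegral (lebesgue_rV R n) D (fun y => complex.Re (F y)) +i*
   Rintegral (lebesgue_rV R n) D (fun y => complex.Im (F y)))%C.

Definition levy_exponent j z : R[i] :=
  complex_integral punctured (fun y =>
    (1 - expi (dotv z y) +
     (\1_[set w | enorm w <= 1] y)%:C%C * ('i%C * (dotv z y)%:C%C))
    * (j y)%:C%C).

Definition condA1 j : Prop :=
  (exists2 C : R, 0 < C & forall p,
     `|complex.Im (levy_exponent j p)|
       <= C * (enorm p ^+ 2 + `|complex.Re (levy_exponent j p)|)) /\
  (forall r : R, 0 < r ->
     (0 < ereal_sup [set (enorm p ^+ 2 + complex.Re (levy_exponent j p))%:E
                    | p in [set p | (enorm p <= r)%R]])%E).

(* phi is in C^2(closure N) for an open set N: phi and its partial derivatives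
   g_i, h_ik of order at most 2 in N extend continuously to closure N. *)
Definition C2_closure N phi : Prop :=
  {within closure N, continuous phi} /\
  exists (g : 'I_n -> 'rV[R]_n -> R) (h : 'I_n -> 'I_n -> 'rV[R]_n -> R),
    (forall i, {within closure N, continuous (g i)} /\
       forall x, N x -> is_derive x (delta_mx 0 i) phi (g i x)) /\
    (forall i k, {within closure N, continuous (h i k)} /\
       forall x, N x -> is_derive x (delta_mx 0 k) (g i) (h i k x)).

Definition lsc_on D u : Prop :=
  lower_semicontinuous (fun x : subspace D => (u x)%:E).

Definition usc_on D u : Prop := lsc_on D (fun x => - u x).

(* [patch u N phi] is the function equal to phi in N and to u elsewhere. *)
Definition viscosity_subsolution j D u h : Prop :=
  [/\ bounded_fun u, measurable_fun setT u, usc_on (closure D) u &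
   forall x N phi, D x -> open N -> N x -> N `<=` D -> C2_closure N phi ->
     phi x - u x = 0 -> (forall y, N y -> 0 <= phi y - u y) ->
     ((h x)%:E <= levy_op j (patch u N phi) x)%E].

Definition viscosity_supersolution j D u h : Prop :=
  [/\ bounded_fun u, measurable_fun setT u, lsc_on (closure D) u &
   forall x N phi, D x -> open N -> N x -> N `<=` D -> C2_closure N phi ->
     phi x - u x = 0 -> (forall y, N y -> phi y - u y <= 0) ->
     (levy_op j (patch u N phi) x <= (h x)%:E)%E].

Definition viscosity_solution j D u h : Prop :=
  viscosity_subsolution j D u h /\ viscosity_supersolution j D u h.

End operator.

Definition C1_fun (R : realType) (f : R -> R) : Prop :=
  (forall r, derivable f r 1) /\ continuous (derive1 f).

(* Main.v *)
Require Import Defs.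
From mathcomp Require Import all_boot all_order all_algebra.
From mathcomp Require Import all_classical all_reals all_analysis.
From mathcomp Require Import measurable_realfun ring lra.

(* Sliding method.  A trigonometric polynomial is mapped by L, hence by the
   resolvent (1 - L)^-1, to a trigonometric polynomial, and a bounded continuous
   function is a locally uniform limit of uniformly bounded trigonometric
   polynomials (Bernstein polynomials in the sines of the rescaled coordinates).
   Comparing u with the resolvent of trigonometric approximations of u - f(u)
   shows that (u, f(u)) is a locally uniform limit of pairs (v, L v) with v a
   trigonometric polynomial.  This notion of solution is linear, so that it
   passes to the differences w = u(. + h) - u without any doubling of variables.
   The Ishii-Lions argument for the smooth functions v makes u Lipschitz.  As
   f' > 0 near and beyond +-1, u(. + t nu) >= u for every nu with positive last
   coordinate and t large, by the maximum principle; a quantitative strong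
   maximum principle allows t to decrease to 0, since otherwise u(. + t nu) - u
   would be small along many consecutive points x + i t nu, between which u
   increases from nearly -1 to nearly 1.  Horizontal directions are limits of
   such nu, hence u depends on the last coordinate only. *)

Set Implicit Arguments.
Unset Strict Implicit.
Unset Printing Implicit Defensive.

Import Order.TTheory GRing.Theory Num.Theory.
Import numFieldNormedType.Exports.

Local Open Scope classical_set_scope.
Local Open Scope ring_scope.

(** Two obstacles shape the proof. The density [j] has no moment at infinity, so L of an unbounded
    function such as |x|^2 may diverge. Extrema over the whole space are therefore produced by the
    bounded penalty K (1 - exp(- a |x|^2)): K only has to beat the oscillation of the function at
    hand, and L of the penalty tends to 0 uniformly as a tends to 0. The strip |x_d| <= M is
    unbounded in the horizontal directions; instead of translating and extracting limits, every
    estimate has explicit dependencies: the Lipschitz constant depends only on a common bound of v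
    and L v, and the lower bound of the strong maximum principle only on the Lipschitz constant, the
    zeroth-order coefficient, the height and the distance. Regularity comes from the Laplacian
    alone: in the Ishii-Lions step the jump part enters only through the sign of its increments at a
    maximum. *)

(** * Calculus on lines *)

Section calculus.
Variable R : realType.

Lemma derive_continuous (a a' : R -> R) :
  (forall s : R, is_derive s 1 a (a' s)) -> continuous a.
Proof.
by move=> da s; apply/differentiable_continuous/derivable1_diffP; case: (da s).
Qed.

(** Two applications of the mean value theorem; this loses the factor 1/2 of Taylor's formula. *)
Lemma taylor1_bound (a a' a'' : R -> R) (M : R) :
  (forall s : R, is_derive s 1 a (a' s)) -> (forall s : R, is_derive s 1 a' (a'' s)) ->
  (forall s, `|a'' s| <= M) -> `|a 1 - a 0 - a' 0| <= M.
Proof.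
move=> da da' Ma.
have [c + ac] := MVT (@ltr01 R) (fun s _ => da s)
  (continuous_subspaceT (derive_continuous da)).
rewrite in_itv/= => /andP[c0 c1].
have [e _ a'e] := MVT c0 (fun s _ => da' s)
  (continuous_subspaceT (derive_continuous da')).
move: ac a'e; rewrite !subr0 mulr1 => -> ->.
rewrite normrM (gtr0_norm c0).
by rewrite (le_trans (ler_piMr _ (ltW c1)))// Ma.
Qed.

(** If c > 0 then a' t, which is c t + o(t), is positive for small t > 0, and the mean value theorem
    gives a h > a 0. Only the derivative of a' at 0 is involved. *)
Lemma second_derivative_max (a a' : R -> R) (c e : R) :
  0 < e -> (forall s : R, is_derive s 1 a (a' s)) -> is_derive (0 : R) 1 a' c ->
  (forall s, `|s| < e -> a s <= a 0) -> a' 0 = 0 /\ c <= 0.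
Proof.
move=> e0 da dc amax.
have a'0 : a' 0 = 0.
  have abs t : t \in `](- e), e[ -> `|t| < e.
    by rewrite in_itv/= ltr_norml.
  have ee : - e <= e by rewrite ge0_cp// ltW.
  have da0 t : t \in `](- e), e[ -> derivable a t 1 by move=> _; case: (da t).
  have e00 : 0 \in `](- e), e[ by rewrite in_itv/= oppr_lt0 e0.
  have am t : t \in `](- e), e[ -> a t <= a 0 by move=> /abs/amax.
  have [_ <-] := da 0; by have [_ ->] := derive1_at_max ee da0 e00 am.
split => //; rewrite leNgt; apply/negP => c0.
have : (h^-1 * (a' h) @[h --> 0^'] --> c)%classic.
  case: dc => dc <-; rewrite /derive.
  have -> : (fun h : R => h^-1 * a' h) =
      (fun h : R => h^-1 *: ((a' \o shift 0) (h *: 1) - a' 0)).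
    by apply/funext => h /=; rewrite a'0 subr0 addr0 [_%:A]mulr1.
  exact: dc.
move=> /cvgrPdist_lt /(_ c c0) [d /= d0 dP].
pose h := Num.min d e / 2.
have h0 : 0 < h by rewrite /h divr_gt0// lt_min d0.
have hm : h < Num.min d e.
  by rewrite /h ltr_pdivrMr// mulr2n ltr_pMr ?lt_min ?d0// ltrDl.
have /MVT/(_ (fun s _ => da s)) := h0.
move=> /(_ (continuous_subspaceT (derive_continuous da)))[t].
rewrite in_itv/= => /andP[t0 th] aE.
have td : t < d by rewrite (lt_trans th)// (lt_le_trans hm)// ge_min lexx.
have := dP t; rewrite /ball_/= sub0r normrN gtr0_norm// => /(_ td).
rewrite gt_eqF// => /(_ isT); rewrite ltr_norml => /andP[_].
rewrite ltrBlDr ltrDl pmulr_rgt0 ?invr_gt0// => a't.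
have : a h <= a 0.
  by apply: amax; rewrite gtr0_norm// (lt_le_trans hm)// ge_min lexx orbT.
by rewrite -subr_le0 aE leNgt mulr_gt0// subr0.
Qed.

End calculus.

Section lines.
Variables (R : realType) (n : nat).
Implicit Types (x y p : 'rV[R]_n) (f : 'rV[R]_n -> R).

Lemma is_derive_lineP f x v (d : R) :
  is_derive x v f d <-> is_derive (0 : R) 1 (fun s : R => f (s *: v + x)) d.
Proof.
have E : 'D_1 (fun s : R => f (s *: v + x)) 0 = 'D_v f x.
  rewrite /derive; set g1 := fun h => h^-1 *: _; set g2 := fun h => h^-1 *: _.
  suff -> : g1 = g2 by [].
  by apply/funext => h; rewrite /g1 /g2/= addr0 scale0r add0r [_%:A]mulr1.
split=> -[ed vd]; split; rewrite ?E//; first by move/derivable1P : ed.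
  exact/derivable1P.
by rewrite -E.
Qed.

(** The factor c lets points move in opposite directions: [smooth_lipschitz] takes c = 1 and c =
    -1. *)
Lemma is_derive_on_line f x v (g : 'rV[R]_n -> R) (c s : R) :
  (forall z, is_derive z v f (g z)) ->
  is_derive s 1 (fun t : R => f (x + (c * t) *: v)) (c * g (x + (c * s) *: v)).
Proof.
move=> df.
have df1 (t : R) : is_derive t 1 (fun t : R => f (x + t *: v)) (g (x + t *: v)).
  have [ed vd] := df (x + t *: v).
  have E : (fun h : R => h^-1 *: (((fun t : R => f (x + t *: v)) \o shift t)
             (h *: 1) - f (x + t *: v))) =
      (fun h : R => h^-1 *: ((f \o shift (x + t *: v)) (h *: v)
         - f (x + t *: v))).
    apply/funext => h /=; congr (_ *: (f _ - _)).
    by rewrite [_%:A]mulr1 scalerDl addrCA addrA.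
  by split; [rewrite /derivable E|rewrite -vd /derive E].
have dl : is_derive s 1 (fun t : R => c * t) c.
  have : is_derive s 1 (c \*: (id : R -> R)) (c *: (1 : R)) by exact: is_deriveZ.
  by rewrite [_%:A]mulr1.
have := @is_derive1_comp R (fun t : R => f (x + t *: v)) (fun t => c * t) s
  _ _ (df1 _) dl.
by rewrite mulrC.
Qed.

End lines.

(** * The dot product and integration against the Levy density *)

Section dotv_theory.
Variables (R : realType) (n : nat).
Implicit Types (x y z p : 'rV[R]_n).

Lemma dotvC x y : dotv x y = dotv y x.
Proof. by apply: eq_bigr => i _; rewrite mulrC. Qed.

Lemma dotvDl x y z : dotv (x + y) z = dotv x z + dotv y z.
Proof. by rewrite -big_split; apply: eq_bigr => i _; rewrite mxE mulrDl. Qed.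

Lemma dotvDr x y z : dotv x (y + z) = dotv x y + dotv x z.
Proof. by rewrite dotvC dotvDl !(dotvC x). Qed.

Lemma dotvZl (a : R) x y : dotv (a *: x) y = a * dotv x y.
Proof. by rewrite mulr_sumr; apply: eq_bigr => i _; rewrite mxE mulrA. Qed.

Lemma dotvZr (a : R) x y : dotv x (a *: y) = a * dotv x y.
Proof. by rewrite dotvC dotvZl dotvC. Qed.

Lemma dotvNl x y : dotv (- x) y = - dotv x y.
Proof. by rewrite -scaleN1r dotvZl mulN1r. Qed.

Lemma dotvNr x y : dotv x (- y) = - dotv x y.
Proof. by rewrite dotvC dotvNl dotvC. Qed.

Lemma dotv0l x : dotv 0 x = 0.
Proof. by rewrite -(scale0r x) dotvZl mul0r. Qed.

Lemma dotv0r x : dotv x 0 = 0.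
Proof. by rewrite dotvC dotv0l. Qed.

Lemma dotv_delta i x : dotv (delta_mx 0 i) x = x 0 i.
Proof.
rewrite /dotv (bigD1 i)//= big1 ?addr0 ?mxE ?eqxx ?mul1r// => k ki.
by rewrite mxE (negbTE ki) andbF mul0r.
Qed.

Lemma dotv_ge0 x : 0 <= dotv x x.
Proof. by apply: sumr_ge0 => i _; rewrite -expr2 sqr_ge0. Qed.

Lemma sqr_coord_le x i : x 0 i ^+ 2 <= dotv x x.
Proof.
rewrite /dotv (bigD1 i)//= -expr2 lerDl.
by apply: sumr_ge0 => k _; rewrite -expr2 sqr_ge0.
Qed.

Lemma dotv_CS x y : dotv x y ^+ 2 <= dotv x x * dotv y y.
Proof.
have [y0|y0] := eqVneq (dotv y y) 0.
  rewrite y0 mulr0 (_ : dotv x y = 0) ?expr0n//.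
  apply: big1 => i _; suff -> : y 0 i = 0 by rewrite mulr0.
  by apply/eqP; rewrite -sqrf_eq0 eq_le sqr_ge0 -y0 sqr_coord_le.
have yp : 0 < dotv y y by rewrite lt_neqAle eq_sym y0 dotv_ge0.
have := dotv_ge0 (dotv y y *: x - dotv x y *: y).
rewrite !(dotvDl, dotvDr, dotvNl, dotvNr, dotvZl, dotvZr) (dotvC y x).
set a := dotv x x; set b := dotv x y; set c := dotv y y in yp *.
rewrite (_ : _ + _ = c * (a * c - b ^+ 2)); last by ring.
by rewrite pmulr_rge0// subr_ge0.
Qed.

Lemma enorm_sqr x : enorm x ^+ 2 = dotv x x.
Proof. by rewrite sqr_sqrtr// dotv_ge0. Qed.

Lemma enorm_le1 x : (enorm x <= 1) = (dotv x x <= 1).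
Proof. by rewrite /enorm -[X in _ <= X]sqrtr1 ler_psqrt// ?nnegrE ?dotv_ge0. Qed.

Lemma coord_le_norm x i : `|x 0 i| <= `|x|.
Proof.
have /mapP[k Hk ->] : `|x 0 i| \in [seq `|x k.1 k.2| | k : 'I_1 * 'I_n].
  by apply/mapP; exists (0, i) => //=; rewrite mem_enum.
by rewrite [leRHS]/Num.norm /= mx_normrE; apply/bigmax_geP; right => /=; exists k.
Qed.

Lemma norm_le_coord x (r : R) : 0 <= r -> (forall i, `|x 0 i| <= r) -> `|x| <= r.
Proof.
move=> r0 xr; rewrite [leLHS]/Num.norm /= mx_normrE.
by apply: bigmax_le => // -[a b] _ /=; rewrite ord1.
Qed.

Lemma sqr_norm_le_dotv x : `|x| ^+ 2 <= dotv x x.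
Proof.
rewrite -enorm_sqr ler_sqr ?nnegrE ?sqrtr_ge0//.
apply: norm_le_coord => [|i]; first exact: sqrtr_ge0.
by rewrite -sqrtr_sqr ler_psqrt// ?nnegrE ?sqr_ge0 ?dotv_ge0// sqr_coord_le.
Qed.

Lemma dotv_le_sqr_norm x : dotv x x <= n%:R * `|x| ^+ 2.
Proof.
have -> : n%:R * `|x| ^+ 2 = \sum_(i < n) `|x| ^+ 2.
  by rewrite sumr_const card_ord mulr_natl.
apply: ler_sum => i _; rewrite -expr2 -real_normK ?num_real//.
by rewrite ler_sqr ?nnegrE// coord_le_norm.
Qed.

Lemma continuous_sum_fun (T : topologicalType) (I : Type) (s : seq I)
    (F : I -> T -> R) :
  (forall i, continuous (F i)) -> continuous (fun t => \sum_(i <- s) F i t).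
Proof.
move=> cF; elim: s => [|i s IHs].
  rewrite (_ : (fun _ => _) = cst 0); first exact: cst_continuous.
  by apply/funext => x; rewrite big_nil.
rewrite (_ : (fun _ => _) = (fun t => F i t + \sum_(i <- s) F i t)).
  by move=> t; apply: cvgD; [exact: cF|exact: IHs].
by apply/funext => t; rewrite big_cons.
Qed.

Lemma continuous_dotvl p : continuous (fun x => dotv x p).
Proof.
apply: (@continuous_sum_fun _ _ _ (fun i x => x 0 i * p 0 i)) => i.
move=> x; apply: (@continuousM _ _ (fun x => x 0 i) (fun=> p 0 i)).
  exact: (@coord_continuous R 1 n 0 i).
exact: cst_continuous.
Qed.

Lemma continuous_sqdotv : continuous (fun x => dotv x x).
Proof.
apply: (@continuous_sum_fun _ _ _ (fun i x => x 0 i * x 0 i)) => i.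
by move=> x; apply: (@continuousM _ _ (fun x => x 0 i) (fun x => x 0 i));
  exact: (@coord_continuous R 1 n 0 i).
Qed.

Lemma continuous_addl p (T : topologicalType) (f : 'rV[R]_n -> T) :
  continuous f -> continuous (fun x => f (p + x)).
Proof.
move=> cf x; apply: (@continuous_comp _ _ _ (fun x => p + x) f); last exact: cf.
by apply: (@continuousD _ _ _ (fun=> p) id); [exact: cst_continuous|exact: cvg_id].
Qed.

Lemma compact_norm_ball x1 (r : R) : compact [set x | `|- x1 + x| <= r].
Proof.
apply: bounded_closed_compact.
  exists (`|x1| + r); split; first exact: num_real.
  move=> M M1 x Ax; apply: le_trans (ltW M1).
  rewrite -[x](addKr (- x1)) opprK; apply: le_trans (ler_normD _ _) _.
  by rewrite lerD2l; exact: Ax.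
have -> : [set x | `|- x1 + x| <= r] = (fun x => `|- x1 + x|) @^-1` [set t | t <= r].
  by [].
apply: closed_comp; last exact: closed_le.
move=> x _; apply: (@continuous_addl (- x1) _ (fun x => `|x|)).
exact: norm_continuous.
Qed.

End dotv_theory.

Section levy_integral.
Variables (R : realType) (n : nat) (j : 'rV[R]_n -> R).
Hypothesis hj : levy_density j.
Implicit Types (x y : 'rV[R]_n) (F : 'rV[R]_n -> R).

Local Notation mu := (lebesgue_rV R n).

Definition levy_weight y : R := Num.min 1 (enorm y ^+ 2).

Definition levy_int F : R := Rintegral mu (@punctured R n) (fun y => F y * j y).

(** Domination by the weight of [levy_density], which makes [F y * j y] integrable. *)
Definition levy_admissible F : Prop :=
  measurable_fun [set: 'rV[R]_n] F /\
  exists M, forall y, `|F y| <= M * levy_weight y.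

Lemma levy_weight_ge0 y : 0 <= levy_weight y.
Proof. by rewrite le_min ler01 sqr_ge0. Qed.

Lemma measurable_levy_weight : measurable_fun [set: 'rV[R]_n] levy_weight.
Proof.
apply: continuous_measurable_rV; rewrite /levy_weight => x.
apply: (@continuous_min _ _ (cst 1) (fun y => enorm y ^+ 2)).
  exact: cst_continuous.
rewrite (_ : (fun y => _) = (fun y => dotv y y)).
  exact: continuous_sqdotv.
by apply/funext => y; rewrite enorm_sqr.
Qed.

Lemma measurable_punctured : measurable (@punctured R n).
Proof.
apply: open_measurable_rV.
rewrite (_ : @punctured R n = [set y | 0 < dotv y y]).
  exact: (proj1 (continuousP _) (@continuous_sqdotv R n) _ (@open_gt R 0)).
apply/seteqP; split => y /=.
  move=> y0; rewrite lt_neqAle dotv_ge0 andbT eq_sym.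
  apply: contraNN y0 => /eqP y0; apply/eqP/rowP => i; rewrite mxE.
  by apply/eqP; rewrite -sqrf_eq0 eq_le sqr_ge0 -y0 sqr_coord_le.
by move=> y0; apply/eqP => yE; rewrite yE dotv0l ltxx in y0.
Qed.

Lemma integrable_levy_weight :
  mu.-integrable (@punctured R n) (EFin \o (fun y => levy_weight y * j y)).
Proof.
have [j0 mj foo] := hj; apply/integrableP; split.
  apply/measurable_EFinP; apply: measurable_funM => //.
  exact: measurable_funTS measurable_levy_weight.
have mwj : measurable_fun (@punctured R n) (fun y => levy_weight y * j y).
  by apply: measurable_funM => //; exact: measurable_funTS measurable_levy_weight.
apply: le_lt_trans foo; apply: ge0_le_integral => //=.
- exact: measurable_punctured.
- by apply/measurable_EFinP; exact: measurableT_comp.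
- exact/measurable_EFinP.
- move=> y y0; rewrite lee_fin ger0_norm//; rewrite mulr_ge0 ?j0//.
  exact: levy_weight_ge0.
Qed.

Lemma levy_weight_admissible : levy_admissible levy_weight.
Proof.
split; first exact: measurable_levy_weight.
by exists 1 => y; rewrite mul1r ger0_norm// levy_weight_ge0.
Qed.

Lemma levy_integrable F : levy_admissible F ->
  mu.-integrable (@punctured R n) (EFin \o (fun y => F y * j y)).
Proof.
move=> [mF [M FM]]; have [j0 mj foo] := hj.
have := @integrableZl _ _ _ mu _ measurable_punctured M _ integrable_levy_weight.
apply: le_integrable.
- exact: measurable_punctured.
- apply/measurable_EFinP; apply: measurable_funM => //.
  exact: measurable_funTS.
- move=> y y0 /=; rewrite lee_fin mulrA (normrM (F y)) (normrM (M * _)).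
  by rewrite ler_wpM2r// (le_trans (FM y))// ler_norm.
Qed.

Lemma levy_admissibleZ (a : R) F :
  levy_admissible F -> levy_admissible (fun y => a * F y).
Proof.
move=> [mF [M FM]]; split; first exact: measurable_funM.
by exists (`|a| * M) => y; rewrite normrM -mulrA ler_wpM2l.
Qed.

Lemma levy_intD F G : levy_admissible F -> levy_admissible G ->
  levy_int (F \+ G) = levy_int F + levy_int G.
Proof.
move=> /levy_integrable iF /levy_integrable iG.
rewrite /levy_int -RintegralD//; last exact: measurable_punctured.
by apply: eq_Rintegral => y _ /=; rewrite mulrDl.
Qed.

Lemma levy_intZ (a : R) F : levy_admissible F ->
  levy_int (fun y => a * F y) = a * levy_int F.
Proof.
move=> /levy_integrable iF.
rewrite /levy_int -RintegralZl//; last exact: measurable_punctured.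
by apply: eq_Rintegral => y _ /=; rewrite mulrA.
Qed.

Lemma le_levy_int F G : levy_admissible F -> levy_admissible G ->
  (forall y, F y <= G y) -> levy_int F <= levy_int G.
Proof.
move=> /levy_integrable iF /levy_integrable iG FG.
apply: le_Rintegral => //; first exact: measurable_punctured.
by move=> y y0; have [j0 _ _] := hj; rewrite ler_wpM2r ?j0.
Qed.

Lemma levy_int_le0 F : levy_admissible F -> (forall y, F y <= 0) ->
  levy_int F <= 0.
Proof.
move=> aF F0; have a0 : levy_admissible (fun y => 0 * F y).
  exact: levy_admissibleZ.
rewrite (le_trans (le_levy_int aF a0 _))//; last by rewrite levy_intZ// mul0r.
by move=> y; rewrite mul0r.
Qed.

Lemma levy_int_abs F G : levy_admissible F -> levy_admissible G ->
  (forall y, `|F y| <= G y) -> `|levy_int F| <= levy_int G.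
Proof.
move=> aF aG FG; rewrite ler_norml; apply/andP; split.
  rewrite -mulN1r -levy_intZ//; apply: le_levy_int => //.
    exact: levy_admissibleZ.
  by move=> y; rewrite mulN1r; have := FG y; rewrite ler_norml => /andP[].
apply: le_levy_int => // y; exact: le_trans (ler_norm _) (FG y).
Qed.

Lemma levy_int_fin F : levy_admissible F ->
  (\int[mu]_(y in @punctured R n) (F y * j y)%:E)%E = (levy_int F)%:E.
Proof.
move=> /levy_integrable iF; rewrite /levy_int /Rintegral fineK//.
by apply: integrable_fin_num => //; exact: measurable_punctured.
Qed.

(** Dominates, up to the factor 8, the increments of a Gaussian of width [k.+1]. The divisor is
    [k.+1] and not its square because the first-order term, of size |y| / k.+1, is not compensated
    for |y| > 1. *)
Definition levy_trunc (k : nat) y : R := Num.min 1 (enorm y ^+ 2 / k.+1%:R).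

Lemma levy_trunc_ge0 k y : 0 <= levy_trunc k y.
Proof. by rewrite le_min ler01 divr_ge0 ?sqr_ge0. Qed.

Lemma measurable_levy_trunc k : measurable_fun [set: 'rV[R]_n] (levy_trunc k).
Proof.
apply: continuous_measurable_rV; rewrite /levy_trunc => x.
apply: (@continuous_min _ _ (cst 1) (fun y => enorm y ^+ 2 / k.+1%:R)).
  exact: cst_continuous.
rewrite (_ : (fun y => _) = (fun y => dotv y y / k.+1%:R)).
  apply: (@continuousM _ _ (fun y => dotv y y) (fun=> k.+1%:R^-1)).
    exact: continuous_sqdotv.
  exact: cst_continuous.
by apply/funext => y; rewrite enorm_sqr.
Qed.

Lemma levy_trunc_le_weight k y : levy_trunc k y <= levy_weight y.
Proof.
rewrite le_min ge_min lexx/= ge_min; apply/orP; right.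
by rewrite ler_pdivrMr// ler_peMr ?sqr_ge0// ler1n.
Qed.

Lemma levy_trunc_admissible k : levy_admissible (levy_trunc k).
Proof.
split; first exact: measurable_levy_trunc.
exists 1 => y; rewrite mul1r ger0_norm ?levy_trunc_le_weight//.
exact: levy_trunc_ge0.
Qed.

Lemma levy_int_trunc_cvg0 : levy_int (levy_trunc k) @[k --> \oo] --> 0.
Proof.
have [j0 mj foo] := hj.
have [] := @dominated_convergence _ _ _ mu _ measurable_punctured
  (fun k y => (levy_trunc k y * j y)%:E) (cst 0%E)
  (EFin \o (fun y => levy_weight y * j y)).
- move=> k; apply/measurable_EFinP; apply: measurable_funM => //.
  exact: measurable_funTS (measurable_levy_trunc k).
- exact: measurable_cst.
- apply: aeW => y y0; apply: cvg_EFin; first exact: nearW.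
  rewrite -(mul0r (j y)); apply: cvgM; last exact: cvg_cst.
  rewrite (_ : 0 = Num.min 1 (0 : R)); last by rewrite min_r.
  have c0 : (enorm y ^+ 2 / k.+1%:R) @[k --> \oo] --> (0 : R).
    by rewrite -(mulr0 (enorm y ^+ 2)); apply: cvgM; [exact: cvg_cst|exact: cvg_harmonic].
  apply: (@cvg_comp _ _ _ (fun k => enorm y ^+ 2 / k.+1%:R) (Num.min 1)) c0 _.
  apply: (@continuous_min _ _ (cst 1) id); first exact: cst_continuous.
  exact: cvg_id.
- exact: integrable_levy_weight.
- apply: aeW => y k y0; rewrite gee0_abs ?lee_fin; last first.
    by rewrite mulr_ge0 ?levy_trunc_ge0 ?j0.
  by rewrite ler_wpM2r ?j0// levy_trunc_le_weight.
move=> _ _; rewrite integral0_eq// => /fine_cvg.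
by apply: cvg_trans; apply: near_eq_cvg; exact: nearW.
Qed.

End levy_integral.

(** * The operator on smooth bounded functions *)

Section derive_rules.
Variables (R : realType) (V : normedModType R).
Implicit Types (x v : V) (f g : V -> R) (a b c : R).

Lemma is_derive_cstE x v c : is_derive x v (fun=> c) 0.
Proof. exact: is_derive_cst. Qed.

Lemma is_derive_conv x v f a b : a = b -> is_derive x v f a -> is_derive x v f b.
Proof. by move=> ->. Qed.

Lemma is_derive_addE x v f g a b : is_derive x v f a -> is_derive x v g b ->
  is_derive x v (fun y => f y + g y) (a + b).
Proof. exact: is_deriveD. Qed.

Lemma is_derive_mulE x v f g a b : is_derive x v f a -> is_derive x v g b ->
  is_derive x v (fun y => f y * g y) (f x * b + g x * a).
Proof. exact: is_deriveM. Qed.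

Lemma is_derive_scaleE x v f a c : is_derive x v f a ->
  is_derive x v (fun y => c * f y) (c * a).
Proof. exact: is_deriveZ. Qed.

End derive_rules.

Section derive_rules1.
Variable R : realType.
Implicit Types (s a b c : R) (f : R -> R).

Lemma is_derive_idE s : is_derive s 1 (fun t : R => t) 1.
Proof. exact: is_derive_id. Qed.

Lemma is_derive_cosE s f a : is_derive s 1 f a ->
  is_derive s 1 (fun t : R => cos (f t)) (- sin (f s) * a).
Proof. exact: is_derive1_comp. Qed.

Lemma is_derive_sinE s f a : is_derive s 1 f a ->
  is_derive s 1 (fun t : R => sin (f t)) (cos (f s) * a).
Proof. exact: is_derive1_comp. Qed.

End derive_rules1.

Section levy_operator.
Variables (R : realType) (n : nat).
Implicit Types (x y z p h : 'rV[R]_n) (phi psi : 'rV[R]_n -> R).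

(** [C2b_taylor] controls the small jumps and [C2b_bound] the large ones. Derivatives are explicit
    functions, so that they can be computed for sums, multiples and translates. *)
Record C2b phi (G : 'I_n -> 'rV[R]_n -> R)
    (H : 'I_n -> 'I_n -> 'rV[R]_n -> R) : Prop := {
  C2b_cont : continuous phi;
  C2b_cont1 : forall i, continuous (G i);
  C2b_cont2 : forall i k, continuous (H i k);
  C2b_der1 : forall i x, is_derive x (delta_mx 0 i) phi (G i x);
  C2b_der2 : forall i k x, is_derive x (delta_mx 0 k) (G i) (H i k x);
  C2b_bound : exists M, forall x, `|phi x| <= M;
  C2b_taylor : exists M, forall x y,
    `|phi (x + y) - phi x - \sum_(i < n) y 0 i * G i x| <= M * dotv y y }.

Arguments C2b_cont {phi G H} c x : rename.
Arguments C2b_cont1 {phi G H} c i x : rename.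
Arguments C2b_cont2 {phi G H} c i k x : rename.
Arguments C2b_der1 {phi G H} c i x : rename.
Arguments C2b_der2 {phi G H} c i k x : rename.

Definition smooth phi : Prop := exists G H, @C2b phi G H.

Lemma C2b_grad phi G H x : C2b phi G H -> grad phi x = \row_i G i x.
Proof.
by move=> c; apply/rowP => i; rewrite !mxE; case: (C2b_der1 c i x).
Qed.

Lemma C2b_laplacian phi G H x : C2b phi G H ->
  laplacian phi x = \sum_(i < n) H i i x.
Proof.
move=> c; apply: eq_bigr => i _.
rewrite (_ : (fun y => 'D_(delta_mx 0 i) phi y) = G i).
  by case: (C2b_der2 c i i x).
by apply/funext => y; case: (C2b_der1 c i y).
Qed.

Lemma C2b_dotv_grad phi G H x y : C2b phi G H ->
  dotv y (grad phi x) = \sum_(i < n) y 0 i * G i x.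
Proof. by move=> c; rewrite (C2b_grad _ c); apply: eq_bigr => i _; rewrite mxE. Qed.

Lemma C2b_closure phi G H : C2b phi G H -> C2_closure setT phi.
Proof.
move=> c; split; first exact: continuous_subspaceT (C2b_cont c).
exists G, H; split => [i|i k]; split.
- exact: continuous_subspaceT (C2b_cont1 c i).
- by move=> x _; exact: C2b_der1 c i x.
- exact: continuous_subspaceT (C2b_cont2 c i k).
- by move=> x _; exact: C2b_der2 c i k x.
Qed.

Lemma C2bD phi G H psi G' H' : C2b phi G H -> C2b psi G' H' ->
  C2b (fun x => phi x + psi x) (fun i x => G i x + G' i x)
      (fun i k x => H i k x + H' i k x).
Proof.
move=> c c'; split.
- by move=> x; apply: continuousD; [exact: C2b_cont c x|exact: C2b_cont c' x].
- by move=> i x; apply: continuousD; [exact: C2b_cont1 c i x|exact: C2b_cont1 c' i x].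
- move=> i k x; apply: continuousD; first exact: C2b_cont2 c i k x.
  exact: C2b_cont2 c' i k x.
- by move=> i x; apply: is_derive_addE; [exact: C2b_der1 c i x|exact: C2b_der1 c' i x].
- move=> i k x; apply: is_derive_addE; first exact: C2b_der2 c i k x.
  exact: C2b_der2 c' i k x.
- have [M hM] := C2b_bound c; have [M' hM'] := C2b_bound c'.
  by exists (M + M') => x; rewrite (le_trans (ler_normD _ _))// lerD.
have [M hM] := C2b_taylor c; have [M' hM'] := C2b_taylor c'.
exists (M + M') => x y; rewrite mulrDl.
have -> : \sum_(i < n) y 0 i * (G i x + G' i x) =
    \sum_(i < n) y 0 i * G i x + \sum_(i < n) y 0 i * G' i x.
  by rewrite -big_split/=; apply: eq_bigr => i _; rewrite mulrDr.
apply: le_trans (lerD (hM x y) (hM' x y)).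
apply: le_trans (ler_normD _ _); rewrite le_eqVlt; apply/orP; left; apply/eqP.
by congr (`| _ |); ring.
Qed.

Lemma C2bZ a phi G H : C2b phi G H ->
  C2b (fun x => a * phi x) (fun i x => a * G i x) (fun i k x => a * H i k x).
Proof.
move=> c; split.
- by move=> x; apply: continuousM; [exact: cst_continuous|exact: C2b_cont c x].
- by move=> i x; apply: continuousM; [exact: cst_continuous|exact: C2b_cont1 c i x].
- by move=> i k x; apply: continuousM; [exact: cst_continuous|exact: C2b_cont2 c i k x].
- by move=> i x; apply: is_derive_scaleE; exact: C2b_der1 c i x.
- by move=> i k x; apply: is_derive_scaleE; exact: C2b_der2 c i k x.
- have [M hM] := C2b_bound c.
  by exists (`|a| * M) => x; rewrite normrM ler_wpM2l.
have [M hM] := C2b_taylor c.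
exists (`|a| * M) => x y; rewrite -mulrA.
have -> : \sum_(i < n) y 0 i * (a * G i x) = a * \sum_(i < n) y 0 i * G i x.
  by rewrite mulr_sumr; apply: eq_bigr => i _; rewrite mulrCA.
by rewrite -!mulrBr normrM ler_wpM2l.
Qed.

Lemma C2b_shift h phi G H : C2b phi G H ->
  C2b (fun x => phi (h + x)) (fun i x => G i (h + x)) (fun i k x => H i k (h + x)).
Proof.
move=> c.
have der i (f g : 'rV[R]_n -> R) x : (forall z, is_derive z (delta_mx 0 i) f (g z)) ->
    is_derive x (delta_mx 0 i) (fun x => f (h + x)) (g (h + x)).
  move=> df; apply/is_derive_lineP.
  have := is_derive_on_line (h + x) 1 0 df.
  rewrite mulr0 scale0r addr0 mul1r.
  rewrite (_ : (fun t => _) = (fun s : R => f (h + (s *: delta_mx 0 i + x))))//.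
  by apply/funext => t; rewrite mul1r addrCA addrC.
split.
- exact: continuous_addl (C2b_cont c).
- by move=> i; exact: continuous_addl (C2b_cont1 c i).
- by move=> i k; exact: continuous_addl (C2b_cont2 c i k).
- by move=> i x; apply: der; exact: C2b_der1 c i.
- by move=> i k x; apply: der; exact: C2b_der2 c i k.
- by have [M hM] := C2b_bound c; exists M.
by have [M hM] := C2b_taylor c; exists M => x y; rewrite addrA.
Qed.

Lemma C2b_cst a : C2b (fun=> a) (fun _ _ => 0) (fun _ _ _ => 0).
Proof.
split; try by move=> *; exact: cst_continuous.
- by move=> *; exact: is_derive_cstE.
- by move=> *; exact: is_derive_cstE.
- by exists `|a|.
exists 0 => x y; rewrite subrr sub0r big1 ?oppr0 ?normr0 ?mul0r// => i _.
by rewrite mulr0.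
Qed.

Variable (j : 'rV[R]_n -> R).
Hypothesis hj : levy_density j.

Definition levy_incr phi x y : R :=
  phi (x + y) - phi x - \1_[set z | enorm z <= 1] y * dotv y (grad phi x).

Definition Lop phi x : R := laplacian phi x + levy_int j (levy_incr phi x).

Lemma levy_weight_in y : dotv y y <= 1 -> levy_weight y = dotv y y.
Proof. by move=> y1; rewrite /levy_weight enorm_sqr min_r. Qed.

Lemma levy_weight_out y : 1 <= dotv y y -> levy_weight y = 1.
Proof. by move=> y1; rewrite /levy_weight enorm_sqr min_l. Qed.

Lemma indic_in y : dotv y y <= 1 -> \1_[set z : 'rV[R]_n | enorm z <= 1] y = 1 :> R.
Proof. by move=> y1; rewrite indicE mem_set//= enorm_le1. Qed.

Lemma indic_out y : 1 < dotv y y -> \1_[set z : 'rV[R]_n | enorm z <= 1] y = 0 :> R.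
Proof.
by move=> y1; rewrite indicE memNset//= enorm_le1; apply/negP; rewrite -ltNge.
Qed.

Lemma measurable_unit_ball : measurable [set z : 'rV[R]_n | enorm z <= 1].
Proof.
rewrite -[X in measurable X]setCK; apply: measurableC; apply: open_measurable_rV.
rewrite (_ : ~` _ = [set y | 1 < dotv y y]).
  exact: (proj1 (continuousP _) (@continuous_sqdotv R n) _ (@open_gt R 1)).
by apply/seteqP; split => y /=; rewrite enorm_le1 ltNge => /negP.
Qed.

Lemma levy_incr_admissible phi x : smooth phi -> levy_admissible (levy_incr phi x).
Proof.
move=> [G [H c]]; split.
  apply: measurable_funB.
    apply: measurable_funB; last exact: measurable_cst.
    by apply: continuous_measurable_rV; exact: continuous_addl (C2b_cont c).
  apply: measurable_funM; first exact: measurable_indic measurable_unit_ball.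
  by apply: continuous_measurable_rV; exact: continuous_dotvl.
have [M hM] := C2b_bound c; have [N hN] := C2b_taylor c.
have M0 : 0 <= M by exact: le_trans (normr_ge0 _) (hM 0).
exists (`|N| + 2 * M) => y; have [y1|y1] := leP (dotv y y) 1.
  rewrite levy_weight_in// /levy_incr indic_in// mul1r (C2b_dotv_grad _ _ c).
  apply: (le_trans (hN x y)); rewrite ler_wpM2r ?dotv_ge0//.
  by rewrite (le_trans (ler_norm _))// lerDl mulr_ge0.
rewrite (levy_weight_out (ltW y1)) /levy_incr indic_out// mul0r subr0 mulr1.
rewrite (le_trans (ler_normB _ _))//.
by have := hM (x + y); have := hM x; have := normr_ge0 N; lra.
Qed.

Lemma levy_opE phi x : smooth phi -> levy_op j phi x = (Lop phi x)%:E.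
Proof.
by move=> sphi; rewrite /levy_op levy_int_fin//; exact: levy_incr_admissible.
Qed.

Lemma C2b_LopE phi G H x : C2b phi G H ->
  Lop phi x = \sum_(i < n) H i i x + levy_int j (levy_incr phi x).
Proof. by move=> c; rewrite /Lop (C2b_laplacian _ c). Qed.

Lemma smoothD phi psi : smooth phi -> smooth psi -> smooth (fun x => phi x + psi x).
Proof.
move=> [? [? c]] [? [? c']].
exact: (ex_intro _ _ (ex_intro _ _ (C2bD c c'))).
Qed.

Lemma smoothZ a phi : smooth phi -> smooth (fun x => a * phi x).
Proof. by move=> [? [? c]]; exact: (ex_intro _ _ (ex_intro _ _ (C2bZ a c))). Qed.

Lemma smooth_shift h phi : smooth phi -> smooth (fun x => phi (h + x)).
Proof. by move=> [? [? c]]; exact: (ex_intro _ _ (ex_intro _ _ (C2b_shift h c))). Qed.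

Lemma smooth_cst a : smooth (fun=> a).
Proof. by exact: (ex_intro _ _ (ex_intro _ _ (C2b_cst a))). Qed.

Lemma smoothB phi psi : smooth phi -> smooth psi -> smooth (fun x => phi x - psi x).
Proof.
move=> sphi spsi; have := smoothD sphi (smoothZ (-1) spsi).
by congr smooth; apply/funext => x; rewrite mulN1r.
Qed.

Lemma LopD phi psi x : smooth phi -> smooth psi ->
  Lop (fun y => phi y + psi y) x = Lop phi x + Lop psi x.
Proof.
move=> sphi spsi; have aphi := levy_incr_admissible x sphi.
have apsi := levy_incr_admissible x spsi.
have [G [H c]] := sphi; have [G' [H' c']] := spsi.
rewrite (C2b_LopE _ (C2bD c c')) (C2b_LopE _ c) (C2b_LopE _ c') big_split/=.
rewrite addrACA -levy_intD//; congr (_ + levy_int j _); apply/funext => y /=.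
rewrite /levy_incr (C2b_dotv_grad _ _ (C2bD c c')) (C2b_dotv_grad _ _ c).
rewrite (C2b_dotv_grad _ _ c').
under eq_bigr do rewrite mulrDr.
by rewrite big_split/=; ring.
Qed.

Lemma LopZ a phi x : smooth phi -> Lop (fun y => a * phi y) x = a * Lop phi x.
Proof.
move=> sphi; have aphi := levy_incr_admissible x sphi.
have [G [H c]] := sphi.
rewrite (C2b_LopE _ (C2bZ a c)) (C2b_LopE _ c) mulrDr -levy_intZ//.
rewrite -mulr_sumr; congr (_ + levy_int j _); apply/funext => y /=.
rewrite /levy_incr (C2b_dotv_grad _ _ (C2bZ a c)) (C2b_dotv_grad _ _ c).
under eq_bigr do rewrite mulrCA.
by rewrite -mulr_sumr; ring.
Qed.

Lemma Lop_linear a b phi psi x : smooth phi -> smooth psi ->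
  Lop (fun y => a * phi y + b * psi y) x = a * Lop phi x + b * Lop psi x.
Proof. by move=> sphi spsi; rewrite LopD ?LopZ//; exact: smoothZ. Qed.

Lemma LopB phi psi x : smooth phi -> smooth psi ->
  Lop (fun y => phi y - psi y) x = Lop phi x - Lop psi x.
Proof.
move=> sphi spsi.
have -> : (fun y => phi y - psi y) = (fun y => phi y + -1 * psi y).
  by apply/funext => y; rewrite mulN1r.
by rewrite LopD ?LopZ ?mulN1r//; exact: smoothZ.
Qed.

Lemma Lop_shift h phi x : smooth phi -> Lop (fun y => phi (h + y)) x = Lop phi (h + x).
Proof.
move=> [G [H c]].
rewrite (C2b_LopE _ (C2b_shift h c)) (C2b_LopE _ c); congr (_ + levy_int j _).
apply/funext => y; rewrite /levy_incr (C2b_dotv_grad _ _ (C2b_shift h c)).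
by rewrite (C2b_dotv_grad _ _ c) addrA.
Qed.

Lemma Lop_cst a x : Lop (fun=> a) x = 0.
Proof.
rewrite (C2b_LopE _ (C2b_cst a)) big1// add0r.
rewrite -[RHS](mul0r (levy_int j (@levy_weight R n))) -levy_intZ//.
  congr (levy_int j _); apply/funext => y.
  rewrite /levy_incr (C2b_dotv_grad _ _ (C2b_cst a)) big1 ?mulr0 ?subrr ?mul0r//.
  by move=> i _; rewrite mulr0.
exact: levy_weight_admissible.
Qed.

Lemma C2b_max phi G H x : C2b phi G H -> (forall y, phi y <= phi x) ->
  forall i, G i x = 0 /\ H i i x <= 0.
Proof.
move=> c mx i.
have d1 s := is_derive_on_line x 1 s (C2b_der1 c i).
have := is_derive_on_line x 1 0 (C2b_der2 c i i).
move=> /(is_derive_scaleE 1) d2.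
have mx0 (s : R) : `|s| < 1 ->
    phi (x + (1 * s) *: delta_mx 0 i) <= phi (x + (1 * 0) *: delta_mx 0 i).
  by move=> _; rewrite mulr0 scale0r addr0.
have := second_derivative_max (@ltr01 R) d1 d2 mx0.
by rewrite !mul1r scale0r addr0.
Qed.

(** The gradient vanishes at the maximum, so the jump part integrates [phi (x + y) - phi x], which
    is nonpositive. The second derivatives are kept because [smooth_lipschitz] needs the one along
    its direction. *)
Lemma C2b_max_Lop phi G H x : C2b phi G H -> (forall y, phi y <= phi x) ->
  Lop phi x <= \sum_(i < n) H i i x.
Proof.
move=> c mx; rewrite (C2b_LopE _ c) gerDl; apply: levy_int_le0 => //.
  by apply: levy_incr_admissible; exists G, H.
move=> y; rewrite /levy_incr (C2b_dotv_grad _ _ c) big1.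
  by rewrite mulr0 subr0 subr_le0.
by move=> i _; have [-> _] := C2b_max c mx i; rewrite mulr0.
Qed.

Lemma Lop_max phi x : smooth phi -> (forall y, phi y <= phi x) -> Lop phi x <= 0.
Proof.
move=> [G [H c]] mx; apply: le_trans (C2b_max_Lop c mx) _.
by apply: sumr_le0 => i _; have [] := C2b_max c mx i.
Qed.

End levy_operator.

(** * Plane waves and Gaussians *)

Section smooth_examples.
Variables (R : realType) (n : nat).
Implicit Types (x y z p v : 'rV[R]_n) (f : 'rV[R]_n -> R) (a b : R).

Lemma is_derive_compE (g : R -> R) f x v a b :
  is_derive (f x) 1 g b -> is_derive x v f a ->
  is_derive x v (fun y => g (f y)) (b * a).
Proof.
move=> dg /is_derive_lineP df; apply/is_derive_lineP.
have dg' : is_derive (f ((0 : R) *: v + x)) 1 g b by rewrite scale0r add0r.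
exact: (is_derive1_comp dg' df).
Qed.

Lemma is_derive_dotv p x v : is_derive x v (fun y => dotv y p) (dotv v p).
Proof.
apply/is_derive_lineP.
have -> : (fun s : R => dotv (s *: v + x) p) = (fun s => s * dotv v p + dotv x p).
  by apply/funext => s; rewrite dotvDl dotvZl.
apply: (is_derive_conv _ (is_derive_addE (is_derive_mulE (is_derive_idE 0)
  (is_derive_cstE _ _ (dotv v p))) (is_derive_cstE _ _ (dotv x p)))).
by ring.
Qed.

Lemma is_derive_sqdotv x v : is_derive x v (fun y => dotv y y) (2 * dotv v x).
Proof.
apply/is_derive_lineP.
have -> : (fun s : R => dotv (s *: v + x) (s *: v + x)) =
    (fun s => s * (s * dotv v v + 2 * dotv v x) + dotv x x).
  apply/funext => s; rewrite !(dotvDl, dotvDr, dotvZl, dotvZr) (dotvC x v).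
  by ring.
apply: (is_derive_conv _ (is_derive_addE (is_derive_mulE (is_derive_idE 0)
  (is_derive_addE (is_derive_mulE (is_derive_idE 0)
     (is_derive_cstE _ _ (dotv v v))) (is_derive_cstE _ _ (2 * dotv v x))))
  (is_derive_cstE _ _ (dotv x x)))).
by ring.
Qed.

Lemma is_derive_coord i k x :
  is_derive x (delta_mx 0 k) (fun y => y 0 i) (i == k)%:R.
Proof.
have := is_derive_dotv (delta_mx 0 i) x (delta_mx 0 k).
rewrite dotv_delta mxE eqxx/= eq_sym; congr (is_derive _ _ _ _).
by apply/funext => y; rewrite dotvC dotv_delta.
Qed.

Lemma dotv_sumE x p : \sum_(i < n) x 0 i * p 0 i = dotv x p. Proof. by []. Qed.

Definition cosw p b x : R := cos (dotv x p + b).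

Lemma continuous_phase p b : continuous (fun x => dotv x p + b).
Proof.
move=> x; apply: (@continuousD _ _ _ (fun x => dotv x p) (fun=> b)).
  exact: continuous_dotvl.
exact: cst_continuous.
Qed.

Lemma continuous_compV (g : R -> R) f : continuous g -> continuous f ->
  continuous (fun x => g (f x)).
Proof.
move=> cg cf x; apply: (@continuous_comp _ _ _ f g); first exact: cf.
exact: cg.
Qed.

Lemma continuous_mulV f (g : 'rV[R]_n -> R) : continuous f -> continuous g ->
  continuous (fun x => f x * g x).
Proof.
move=> cf cg x; apply: (@continuousM _ _ f g); first exact: cf.
exact: cg.
Qed.

Lemma continuous_addV f (g : 'rV[R]_n -> R) : continuous f -> continuous g ->
  continuous (fun x => f x + g x).
Proof.
move=> cf cg x; apply: (@continuousD _ _ _ f g); first exact: cf.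
exact: cg.
Qed.

Lemma is_derive_phase p b i x :
  is_derive x (delta_mx 0 i) (fun y => dotv y p + b) (p 0 i).
Proof.
apply: (is_derive_conv _ (is_derive_addE (is_derive_dotv p x (delta_mx 0 i))
  (is_derive_cstE _ _ b))).
by rewrite dotv_delta addr0.
Qed.

Lemma C2b_cosw p b : C2b (cosw p b) (fun i x => - p 0 i * sin (dotv x p + b))
  (fun i k x => - p 0 i * (p 0 k * cos (dotv x p + b))).
Proof.
split.
- by apply: continuous_compV; [exact: continuous_cos|exact: continuous_phase].
- move=> i; apply: continuous_mulV; first exact: cst_continuous.
  by apply: continuous_compV; [exact: continuous_sin|exact: continuous_phase].
- move=> i k; apply: continuous_mulV; first exact: cst_continuous.
  apply: continuous_mulV; first exact: cst_continuous.
  by apply: continuous_compV; [exact: continuous_cos|exact: continuous_phase].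
- move=> i x; have -> : - p 0 i * sin (dotv x p + b) =
      - sin (dotv x p + b) * p 0 i by ring.
  exact: (is_derive_compE (is_derive_cos _) (is_derive_phase p b i x)).
- move=> i k x; apply: is_derive_scaleE; rewrite (mulrC (p 0 k)).
  exact: (is_derive_compE (is_derive_sin _) (is_derive_phase p b k x)).
- by exists 1 => x; rewrite ler_norml cos_geN1 cos_le1.
exists (dotv p p) => x y; set q := dotv x p + b; set t := dotv y p.
have -> : \sum_(i < n) y 0 i * (- p 0 i * sin q) = - (t * sin q).
  by rewrite mulr_suml -sumrN; apply: eq_bigr => i _; ring.
have -> : cosw p b (x + y) = cos (q + 1 * t).
  by rewrite /cosw dotvDl /q /t; congr cos; ring.
have d0 (s : R) : is_derive s 1 (fun s => q + s * t) t.
  apply: (is_derive_conv _ (is_derive_addE (is_derive_cstE _ _ q)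
    (is_derive_mulE (is_derive_idE s) (is_derive_cstE _ _ t)))).
  by ring.
have d1 (s : R) : is_derive s 1 (fun s => cos (q + s * t)) (- t * sin (q + s * t)).
  by rewrite mulNr mulrC -mulNr; exact: is_derive_cosE.
have d2 (s : R) :
    is_derive s 1 (fun s => - t * sin (q + s * t)) (- t * (t * cos (q + s * t))).
  by apply: is_derive_scaleE; rewrite (mulrC t); exact: is_derive_sinE.
have bd (s : R) : `|- t * (t * cos (q + s * t))| <= dotv p p * dotv y y.
  rewrite mulrA mulNr -expr2 normrM normrN (ger0_norm (sqr_ge0 _)).
  rewrite (@le_trans _ _ (t ^+ 2))//.
    by rewrite ler_piMr ?sqr_ge0// ler_norml cos_geN1 cos_le1.
  by rewrite mulrC; exact: dotv_CS.
have := taylor1_bound d1 d2 bd.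
by rewrite mul0r addr0 mulNr /cosw -/q.
Qed.

Lemma smooth_cosw p b : smooth (cosw p b).
Proof. exact: (ex_intro _ _ (ex_intro _ _ (C2b_cosw p b))). Qed.

Definition gauss a x : R := expR (- a * dotv x x).

Lemma gauss_gt0 a x : 0 < gauss a x. Proof. exact: expR_gt0. Qed.

Lemma gauss_le1 a x : 0 <= a -> gauss a x <= 1.
Proof. by move=> a0; rewrite -expR0 ler_expR mulNr oppr_le0 mulr_ge0 ?dotv_ge0. Qed.

Lemma gauss_mul_le1 a x : a * dotv x x * gauss a x <= 1.
Proof.
rewrite /gauss mulNr expRN ler_pdivrMr ?expR_gt0// mul1r.
by have := expR_ge1Dx (a * dotv x x); lra.
Qed.

Lemma is_derive_gauss a x v :
  is_derive x v (gauss a) (- (2 * a) * (dotv v x * gauss a x)).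
Proof.
apply: (is_derive_conv _ (is_derive_compE (is_derive_expR _)
  (is_derive_scaleE (- a) (is_derive_sqdotv x v)))).
by rewrite /gauss; ring.
Qed.

Lemma continuous_gauss a : continuous (gauss a).
Proof.
apply: continuous_compV; first exact: continuous_expR.
by apply: continuous_mulV; [exact: cst_continuous|exact: continuous_sqdotv].
Qed.

(** The left side is the second derivative along y at z. Its two terms are at most 2 a |y|^2 and, by
    Cauchy-Schwarz and [gauss_mul_le1], 4 a |y|^2, whence the 6. *)
Lemma gauss_hess_bound a z y : 0 <= a ->
  `|- (2 * a) * (dotv y y + - (2 * a) * dotv y z ^+ 2) * gauss a z|
    <= 6 * a * dotv y y.
Proof.
move=> a0; have g0 := gauss_gt0 a z; have g1 := gauss_le1 z a0.
have gm := gauss_mul_le1 a z; have CS := dotv_CS y z.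
have y0 := dotv_ge0 y; have s0 := sqr_ge0 (dotv y z).
set G := gauss a z in g0 g1 gm *; set Y := dotv y y in y0 CS *.
set S := dotv y z ^+ 2 in s0 CS *; set Z := dotv z z in gm CS.
have G0 : 0 <= G by exact: ltW.
clearbody G Y S Z.
have h1 : a * (a * S * G) <= a * Y.
  rewrite ler_wpM2l// (@le_trans _ _ (a * (Y * Z) * G))//.
    by rewrite ler_wpM2r// ler_wpM2l.
  rewrite (_ : _ * G = Y * (a * Z * G)); last by ring.
  by rewrite ler_piMr.
have h2 : a * (Y * G) <= a * Y by rewrite ler_wpM2l// ler_piMr.
have h3 : 0 <= a * (Y * G) by rewrite !mulr_ge0.
have h4 : 0 <= a * (a * S * G) by rewrite !mulr_ge0.
rewrite ler_norml; apply/andP; split; lra.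
Qed.

Lemma gauss_taylor a x y : 0 <= a ->
  `|gauss a (x + y) - gauss a x - - (2 * a) * (dotv y x * gauss a x)|
    <= 6 * a * dotv y y.
Proof.
move=> a0.
have d1 (s : R) := is_derive_on_line x 1 s (fun z => is_derive_gauss a z y).
have d2 (s : R) : is_derive s 1
    (fun t : R => 1 * (- (2 * a) *
      (dotv y (x + (1 * t) *: y) * gauss a (x + (1 * t) *: y))))
    (- (2 * a) * (dotv y y + - (2 * a) * dotv y (x + (1 * s) *: y) ^+ 2)
      * gauss a (x + (1 * s) *: y)).
  have d0 : is_derive s 1 (fun s : R => dotv y (x + (1 * s) *: y)) (dotv y y).
    have -> : (fun s : R => dotv y (x + (1 * s) *: y)) =
        (fun s => dotv y x + s * dotv y y).
      by apply/funext => t; rewrite mul1r dotvDr dotvZr.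
    apply: (is_derive_conv _ (is_derive_addE (is_derive_cstE _ _ (dotv y x))
      (is_derive_mulE (is_derive_idE s) (is_derive_cstE _ _ (dotv y y))))).
    by ring.
  apply: (is_derive_conv _ (is_derive_scaleE 1 (is_derive_scaleE (- (2 * a))
    (is_derive_mulE d0 (d1 s))))).
  by ring.
have := taylor1_bound d1 d2 (fun s => gauss_hess_bound _ _ a0).
by rewrite !mul1r scale1r scale0r addr0.
Qed.

Lemma C2b_gauss a : 0 <= a ->
  C2b (gauss a) (fun i x => - (2 * a) * (x 0 i * gauss a x))
    (fun i k x => - (2 * a) * ((i == k)%:R * gauss a x
       + x 0 i * (- (2 * a) * (x 0 k * gauss a x)))).
Proof.
move=> a0; have cg := @continuous_gauss a.
have cc i : continuous (fun x => x 0 i) by exact: (@coord_continuous R 1 n 0 i).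
have ccst (c : R) : continuous (fun _ : 'rV[R]_n => c) by exact: cst_continuous.
have dg i x : is_derive x (delta_mx 0 i) (gauss a) (- (2 * a) * (x 0 i * gauss a x)).
  by rewrite -dotv_delta; exact: is_derive_gauss.
split => //.
- by move=> i; do 2 apply: continuous_mulV => //.
- move=> i k; apply: continuous_mulV => //; apply: continuous_addV.
    exact: continuous_mulV.
  by do 3 apply: continuous_mulV => //.
- move=> i k x; apply: is_derive_scaleE.
  apply: (is_derive_conv _ (is_derive_mulE (is_derive_coord i k x) (dg k x))).
  by ring.
- by exists 1 => x; rewrite ger0_norm ?gauss_le1// ltW// gauss_gt0.
exists (6 * a) => x y; have := gauss_taylor x y a0.
rewrite /dotv mulr_suml mulr_sumr; congr (`|_ - _| <= _).
by apply: eq_bigr => i _; ring.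
Qed.

Lemma smooth_gauss a : 0 <= a -> smooth (gauss a).
Proof. by move=> a0; exact: (ex_intro _ _ (ex_intro _ _ (C2b_gauss a0))). Qed.

Variable (j : 'rV[R]_n -> R).
Hypothesis hj : levy_density j.

Lemma gauss_dotv_grad a x y : 0 <= a ->
  dotv y (grad (gauss a) x) = - (2 * a) * (dotv y x * gauss a x).
Proof.
move=> a0; rewrite (C2b_dotv_grad _ _ (C2b_gauss a0)) /dotv mulr_suml mulr_sumr.
by apply: eq_bigr => i _; ring.
Qed.

Lemma gauss_laplacian a x : 0 <= a ->
  laplacian (gauss a) x = (4 * a ^+ 2 * dotv x x - 2 * n%:R * a) * gauss a x.
Proof.
move=> a0; rewrite (C2b_laplacian _ (C2b_gauss a0)).
under eq_bigr do rewrite eqxx mul1r.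
rewrite (eq_bigr (fun i : 'I_n => 4 * a ^+ 2 * gauss a x * (x 0 i * x 0 i)
   + - (2 * a) * gauss a x)); last by move=> i _; ring.
rewrite big_split/= -mulr_sumr dotv_sumE sumr_const card_ord -mulr_natl.
by ring.
Qed.

(* Convexity of exp bounds the jump part below by a multiple of the value. *)
Lemma Lop_gauss_ge a x : 0 <= a ->
  (4 * a ^+ 2 * dotv x x - 2 * n%:R * a
     - (a + 1) * levy_int j (@levy_weight R n)) * gauss a x <= Lop j (gauss a) x.
Proof.
move=> a0; have g0 := gauss_gt0 a x.
rewrite /Lop gauss_laplacian// mulrBl lerD2l mulrAC -mulNr.
have aw := levy_admissibleZ (- ((a + 1) * gauss a x)) (@levy_weight_admissible R n).
rewrite -levy_intZ//; last exact: levy_weight_admissible.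
apply: le_levy_int => //; first exact: levy_incr_admissible (smooth_gauss a0).
move=> y; have y0 := dotv_ge0 y.
rewrite /levy_incr gauss_dotv_grad//.
have [y1|y1] := leP (dotv y y) 1.
  rewrite indic_in// levy_weight_in// mul1r.
  have -> : gauss a (x + y) = gauss a x * expR (- a * (2 * dotv y x + dotv y y)).
    rewrite /gauss -expRD !(dotvDl, dotvDr) (dotvC x y); congr expR; ring.
  have := expR_ge1Dx (- a * (2 * dotv y x + dotv y y)).
  move=> /(ler_wpM2l (ltW g0)).
  have : 0 <= gauss a x * dotv y y by rewrite mulr_ge0//; exact: ltW.
  by set E := expR _; set G := gauss a x; lra.
(* For large jumps positivity of [gauss a (x + y)] is enough. *)
rewrite indic_out// (levy_weight_out (ltW y1)) mul0r subr0 mulr1.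
have := gauss_gt0 a (x + y); have : 0 <= a * gauss a x by rewrite mulr_ge0//; exact: ltW.
by lra.
Qed.

(** The constant 8 is 6 from the Taylor remainder plus 2 from the gradient term, which stays in play
    for |y| > 1. *)
Lemma levy_incr_gauss_le (k : nat) x y :
  `|levy_incr (gauss (k.+1%:R^-1 ^+ 2)) x y| <= 8 * levy_trunc k y.
Proof.
set s : R := k.+1%:R^-1; set a := s ^+ 2.
have s0 : 0 < s by rewrite invr_gt0.
have s1 : s <= 1 by rewrite invf_le1// ler1n.
have a0 : 0 <= a by rewrite sqr_ge0.
have as_ : a <= s by rewrite /a expr2 ler_piMr//; exact: ltW.
have y0 := dotv_ge0 y; have g0 := gauss_gt0 a x; have g1 := gauss_le1 x a0.
have T := gauss_taylor x y a0.
have ay : a * dotv y y <= s * dotv y y by rewrite ler_wpM2r.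
rewrite /levy_incr gauss_dotv_grad// /levy_trunc enorm_sqr -/s (mulrC (dotv y y)).
have sy0 : 0 <= s * dotv y y by rewrite mulr_ge0//; exact: ltW.
have [y1|y1] := leP (dotv y y) 1.
  have sy1 : s * dotv y y <= 1 by rewrite mulr_ile1//; exact: ltW.
  rewrite indic_in// mul1r min_r//; apply: (le_trans T); lra.
rewrite indic_out// mul0r subr0.
have g0' := gauss_gt0 a (x + y); have g1' := gauss_le1 (x + y) a0.
have [|_] := leP 1 (s * dotv y y).
  by move=> _; rewrite ler_norml; apply/andP; split; lra.
(* As a = s^2, Cauchy-Schwarz and [gauss_mul_le1] bound the left side by |y|, and |y| <= |y|^2 since
   |y| > 1. *)
have xy : `|s * dotv y x * gauss a x| <= dotv y y.
  rewrite -ler_sqr ?nnegrE// real_normK ?num_real//.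
  have gm := gauss_mul_le1 a x; have CS := dotv_CS y x.
  have h1 : a * dotv y x ^+ 2 * gauss a x ^+ 2 <= dotv y y.
    rewrite (@le_trans _ _ (a * (dotv y y * dotv x x) * gauss a x ^+ 2))//.
      by rewrite ler_wpM2r ?sqr_ge0// ler_wpM2l.
    rewrite (_ : _ * _ = dotv y y * (a * dotv x x * gauss a x * gauss a x)); last by ring.
    rewrite ler_piMr// mulr_ile1//; last exact: ltW.
    by rewrite !mulr_ge0 ?dotv_ge0//; exact: ltW.
  rewrite !exprMn -/a (le_trans h1)// expr2 ler_peMr//; exact: ltW.
have e : 2 * a * (dotv y x * gauss a x) = 2 * (s * dotv y x * gauss a x * s).
  by rewrite /a; ring.
move: xy T; rewrite !ler_norml => /andP[xy1 xy2] /andP[T1 T2].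
have b1 : - dotv y y * s <= s * dotv y x * gauss a x * s.
  by rewrite ler_wpM2r//; exact: ltW.
have b2 : s * dotv y x * gauss a x * s <= dotv y y * s.
  by rewrite ler_wpM2r//; exact: ltW.
by apply/andP; split; lra.
Qed.

(** For wide Gaussians the Laplacian is of order a, and the jump part is small by dominated
    convergence. *)
Lemma Lop_gauss_small (e : R) : 0 < e ->
  exists2 a, 0 < a & forall x, `|Lop j (gauss a) x| <= e.
Proof.
move=> e0.
have c1 : (8 * levy_int j (@levy_trunc R n k)) @[k --> \oo] --> (0 : R).
  rewrite -(mulr0 (8 : R)); apply: cvgM; first exact: cvg_cst.
  exact: levy_int_trunc_cvg0.
have c2 : (6 * n%:R * k.+1%:R^-1) @[k --> \oo] --> (0 : R).
  by rewrite -(mulr0 (6 * n%:R : R)); apply: cvgM; [exact: cvg_cst|exact: cvg_harmonic].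
have c3 : (8 * levy_int j (@levy_trunc R n k) + 6 * n%:R * k.+1%:R^-1)
    @[k --> \oo] --> (0 : R).
  by rewrite -[X in _ --> X]addr0; exact: cvgD.
move/cvgrPdist_lt : c3 => /(_ e e0).
case.
move=> k _ /(_ k (leqnn k)); rewrite /= sub0r normrN => /ltW/(le_trans (ler_norm _)) kP.
set s : R := k.+1%:R^-1 in kP; pose a := s ^+ 2.
have s0 : 0 < s by rewrite invr_gt0.
have s1 : s <= 1 by rewrite invf_le1// ler1n.
have a0 : 0 <= a by rewrite sqr_ge0.
exists a; first by rewrite exprn_gt0.
move=> x; rewrite /Lop (le_trans (ler_normD _ _))// addrC (le_trans _ kP)// lerD//.
  rewrite -levy_intZ//; last exact: levy_trunc_admissible.
  apply: levy_int_abs => //.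
  - exact: levy_incr_admissible (smooth_gauss a0).
  - by apply: levy_admissibleZ; exact: levy_trunc_admissible.
  - by move=> y; exact: levy_incr_gauss_le.
have as_ : a <= s by rewrite /a expr2 ler_piMr//; exact: ltW.
rewrite (C2b_laplacian _ (C2b_gauss a0)) (le_trans (ler_norm_sum _ _ _))//.
apply: (@le_trans _ _ (\sum_(i < n) 6 * s)); last first.
  by rewrite sumr_const card_ord -[X in X <= _]mulr_natl; lra.
apply: ler_sum => i _; have := gauss_hess_bound x (delta_mx 0 i) a0.
rewrite !dotv_delta mxE !eqxx/= mulr1 => hb.
apply: le_trans (le_trans hb _); last by rewrite ler_pM2l.
by rewrite le_eqVlt; apply/orP; left; apply/eqP; congr (`| _ |); ring.
Qed.

End smooth_examples.

(** * Trigonometric polynomials and the resolvent *)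

Section trig_polynomials.
Variables (R : realType) (n : nat).
Implicit Types (x y p q : 'rV[R]_n) (v w : 'rV[R]_n -> R) (a b c : R).

(** Each triple is an amplitude, a frequency and a phase; phases make sines a special case of
    cosines and keep everything real. *)
Definition trig v : Prop := exists s : seq (R * 'rV[R]_n * R),
  v = fun x => \sum_(q <- s) q.1.1 * cosw q.1.2 q.2 x.

Lemma trig_ind (P : ('rV[R]_n -> R) -> Prop) :
  P (fun=> 0) ->
  (forall a p b v, trig v -> P v -> P (fun x => a * cosw p b x + v x)) ->
  forall v, trig v -> P v.
Proof.
move=> P0 PS v [s ->]; elim: s => [|[[a p] b] s IHs].
  rewrite (_ : (fun _ => _) = (fun=> 0))//.
  by apply/funext => x; rewrite big_nil.
rewrite (_ : (fun _ => _) = (fun x => a * cosw p b x +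
    \sum_(q <- s) q.1.1 * cosw q.1.2 q.2 x)).
  by apply: PS => //; exists s.
by apply/funext => x; rewrite big_cons.
Qed.

Lemma trig0 : trig (fun=> 0).
Proof. by exists [::]; apply/funext => x; rewrite big_nil. Qed.

Lemma trigD v w : trig v -> trig w -> trig (fun x => v x + w x).
Proof.
move=> [s ->] [t ->]; exists (s ++ t).
by apply/funext => x; rewrite big_cat.
Qed.

Lemma trig_cosw p b : trig (cosw p b).
Proof.
by exists [:: (1, p, b)]; apply/funext => x; rewrite big_seq1 mul1r.
Qed.

Lemma trigZ a v : trig v -> trig (fun x => a * v x).
Proof.
move=> [s ->]; exists [seq (a * t.1.1, t.1.2, t.2) | t <- s].
apply/funext => x; rewrite big_map mulr_sumr; apply: eq_bigr => q _ /=.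
by rewrite mulrA.
Qed.

Lemma trig_cst a : trig (fun=> a).
Proof.
have := trigZ a (trig_cosw 0 0); congr trig; apply/funext => x.
by rewrite /cosw dotv0r addr0 cos0 mulr1.
Qed.

Lemma trig_mul_cosw p b v : trig v -> trig (fun x => cosw p b x * v x).
Proof.
move: v; apply: trig_ind.
  by have := trig0; congr trig; apply/funext => x; rewrite mulr0.
move=> a q c v _ tv.
have := trigD (trigD (trigZ (a / 2) (trig_cosw (p + q) (b + c)))
  (trigZ (a / 2) (trig_cosw (p - q) (b - c)))) tv.
congr trig; apply/funext => x; rewrite /cosw !(dotvDr, dotvNr).
rewrite (_ : _ + _ + (b + c) = (dotv x p + b) + (dotv x q + c)); last by ring.
rewrite (_ : _ - _ + (b - c) = (dotv x p + b) - (dotv x q + c)); last by ring.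
by rewrite cosD cosB; field.
Qed.

Lemma trigM v w : trig v -> trig w -> trig (fun x => v x * w x).
Proof.
move=> tv tw; move: v tv; apply: trig_ind.
  by have := trig0; congr trig; apply/funext => x; rewrite mul0r.
move=> a p b v _ tvw.
have := trigD (trigZ a (trig_mul_cosw p b tw)) tvw.
by congr trig; apply/funext => x; rewrite mulrDl mulrA.
Qed.

Lemma trig_sum (I : Type) (s : seq I) (F : I -> 'rV[R]_n -> R) :
  (forall i, trig (F i)) -> trig (fun x => \sum_(i <- s) F i x).
Proof.
move=> tF; elim: s => [|i s IHs].
  by have := trig0; congr trig; apply/funext => x; rewrite big_nil.
by have := trigD (tF i) IHs; congr trig; apply/funext => x; rewrite big_cons.
Qed.

Lemma trig_prod (I : Type) (s : seq I) (F : I -> 'rV[R]_n -> R) :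
  (forall i, trig (F i)) -> trig (fun x => \prod_(i <- s) F i x).
Proof.
move=> tF; elim: s => [|i s IHs].
  by have := trig_cst 1; congr trig; apply/funext => x; rewrite big_nil.
by have := trigM (tF i) IHs; congr trig; apply/funext => x; rewrite big_cons.
Qed.

Lemma trig_smooth v : trig v -> smooth v.
Proof.
move: v; apply: trig_ind; first exact: smooth_cst.
by move=> a p b v _ sv; apply: smoothD => //; apply: smoothZ; exact: smooth_cosw.
Qed.

Lemma trig_shift h v : trig v -> trig (fun x => v (h + x)).
Proof.
move: v; apply: trig_ind; first exact: trig0.
move=> a p b v _ tv; apply: trigD => //; apply: trigZ.
have := trig_cosw p (dotv h p + b); congr trig; apply/funext => x.
by rewrite /cosw dotvDl; congr cos; ring.
Qed.

Variable (j : 'rV[R]_n -> R).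
Hypothesis hj : levy_density j.

Lemma cosw_shift p b x y :
  cosw p b (x + y) = cos (dotv x p + b) * cosw p 0 y
    + - sin (dotv x p + b) * cosw p (- (pi / 2)) y.
Proof.
rewrite /cosw dotvDl addr0 (_ : _ + _ + b = (dotv x p + b) + dotv y p); last by ring.
by rewrite cosD cosB cos_pihalf sin_pihalf; ring.
Qed.

(* [L] commutes with translations, hence acts on the plane waves of frequency
   [p] as a 2x2 matrix, whose diagonal is nonpositive. *)
Lemma Lop_cosw p : exists A B : R, A <= 0 /\ forall b x,
  Lop j (cosw p b) x = A * cos (dotv x p + b) - B * sin (dotv x p + b).
Proof.
exists (Lop j (cosw p 0) 0), (Lop j (cosw p (- (pi / 2))) 0); split.
  (* The coefficient A is L of cos(x.p) at the origin, where this cosine is maximal. *)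
  apply: Lop_max => //; first exact: smooth_cosw.
  by move=> y; rewrite /cosw dotv0l !addr0 cos0 cos_le1.
move=> b x; rewrite -{1}[x]addr0 -(Lop_shift j x 0 (smooth_cosw p b)).
have -> : (fun y => cosw p b (x + y)) = (fun y => cos (dotv x p + b) * cosw p 0 y
    + - sin (dotv x p + b) * cosw p (- (pi / 2)) y).
  by apply/funext => y; exact: cosw_shift.
have s0 := smooth_cosw p 0; have s1 := smooth_cosw p (- (pi / 2)).
apply: etrans (Lop_linear hj _ _ 0 s0 s1) _.
set A := Lop _ _ _; set B := Lop _ _ _; ring.
Qed.

(** On the cosine and sine of one phase, 1 - L is a 2x2 matrix of determinant D = (1 - A)^2 + B^2.
    It is positive because A <= 0, and c1, c2 are given by Cramer's rule. *)
Lemma trig_resolvent g : trig g ->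
  exists v, trig v /\ forall x, v x - Lop j v x = g x.
Proof.
move: g; apply: trig_ind.
  by exists (fun=> 0); split=> [|x]; [exact: trig0|rewrite Lop_cst// subrr].
move=> a p b g _ [v [tv vg]].
have [A [B [A0 LE]]] := Lop_cosw p.
pose D := (1 - A) ^+ 2 + B ^+ 2.
have D0 : D != 0.
  by rewrite gt_eqF// ltr_pwDl ?sqr_ge0// exprn_gt0//; lra.
pose c1 := a * ((1 - A) / D); pose c2 := a * (- B / D).
have t1 := trig_cosw p b; have t2 := trig_cosw p (b - pi / 2).
exists (fun x => (c1 * cosw p b x + c2 * cosw p (b - pi / 2) x) + v x); split.
  by apply: trigD => //; apply: trigD; exact: trigZ.
move=> x; have s1 := trig_smooth t1; have s2 := trig_smooth t2.
have sv := trig_smooth tv.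
have := LopD hj x (smoothD (smoothZ c1 s1) (smoothZ c2 s2)) sv.
rewrite (Lop_linear hj c1 c2 x s1 s2) => ->.
rewrite !LE /cosw addrA cosB sinB cos_pihalf sin_pihalf -vg.
set C := cos _; set S := sin _; set V := Lop j v x.
rewrite /c1 /c2 /D; field.
by rewrite -/D.
Qed.

Lemma penalization (B e : R) : 0 <= B -> 0 < e ->
  exists (z : 'rV[R]_n -> R) (r : R),
  [/\ smooth z, z 0 = 0 /\ forall x, 0 <= z x, forall x, `|Lop j z x| <= e,
      0 <= r & forall x, r < `|x| -> B < z x].
Proof.
(* Outside the radius the Gaussian is at most 1/2, so the penalty is at least K / 2 > B. *)
move=> B0 e0; pose K := 2 * B + 1; have K0 : 0 < K by rewrite /K; lra.
have [a a0 ae] := Lop_gauss_small hj (divr_gt0 e0 K0).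
have sg := smooth_gauss n (ltW a0).
have sz : smooth (fun x : 'rV[R]_n => K - K * gauss a x).
  by apply: smoothB; [exact: smooth_cst|exact: smoothZ].
exists (fun x => K - K * gauss a x), (1 + a^-1); split => //.
- split; first by rewrite /gauss dotv0l mulr0 expR0 mulr1 subrr.
  by move=> x; rewrite subr_ge0 ler_piMr ?gauss_le1// ltW.
- move=> x; rewrite (LopB hj x (smooth_cst _ K) (smoothZ K sg)).
  rewrite (Lop_cst hj) (LopZ hj K x sg) sub0r normrN normrM (gtr0_norm K0).
  by rewrite -ler_pdivlMl// mulrC.
- by rewrite addr_ge0// invr_ge0 ltW.
move=> x xr; have ai : 0 < a^-1 by rewrite invr_gt0.
have ax : 1 <= a * dotv x x.
  rewrite -ler_pdivrMl// mulr1 (le_trans _ (sqr_norm_le_dotv x))//.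
  rewrite expr2 (@le_trans _ _ `|x|)//; first by lra.
  by rewrite ler_peMr//; lra.
have gx : gauss a x <= 2^-1.
  rewrite /gauss mulNr expRN lef_pV2 ?posrE ?expR_gt0//.
  by have := expR_ge1Dx (a * dotv x x); lra.
have := ler_wpM2l (ltW K0) gx; rewrite /K; lra.
Qed.

(** A minimum over the compact ball is global: outside it z exceeds 2 B, the largest possible
    oscillation of F. *)
Lemma penalized_min (F z : 'rV[R]_n -> R) (B r : R) x1 :
  continuous F -> continuous z -> (forall x, `|F x| <= B) ->
  z 0 = 0 -> (forall x, 0 <= z x) -> 0 <= r ->
  (forall x, r < `|x| -> 2 * B < z x) ->
  exists x2, [/\ `|- x1 + x2| <= r, F x2 <= F x1 &
    forall x, F x2 + z (- x1 + x2) <= F x + z (- x1 + x)].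
Proof.
move=> cF cz FB z0 zp r0 zr.
pose A := [set x | `|- x1 + x| <= r].
have cG : continuous (fun x => F x + z (- x1 + x)).
  by apply: continuous_addV => //; exact: continuous_addl.
have cA : compact A by exact: compact_norm_ball.
have A1 : A x1 by rewrite /A/= addNr normr0.
have [|x2 x2A x2m] := EVT_min_rV _ cA (continuous_subspaceT cG).
  by exists x1.
have x2A' : `|- x1 + x2| <= r by move: x2A; rewrite inE.
have m1 := x2m x1 (mem_set A1); rewrite addNr z0 addr0 in m1.
exists x2; split => //; first by rewrite (le_trans _ m1)// lerDl.
move=> x; have [xr|xr] := leP `|- x1 + x| r; first by apply: x2m; rewrite inE.
rewrite (le_trans m1)//; have := zr _ xr.
have := FB x1; have := FB x; rewrite !ler_norml => /andP[? ?] /andP[? ?]; lra.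
Qed.

End trig_polynomials.

(** * Approximation by trigonometric polynomials *)

Section bernstein.
Variable R : realType.
Implicit Types (s : R) (N k : nat).

(* The probability that [N] independent Bernoulli trials of parameter [s] give
   [k] successes. *)
Fixpoint bern s N k : R :=
  if N is N'.+1 then
    (1 - s) * bern s N' k + s * (if k is k'.+1 then bern s N' k' else 0)
  else (k == 0)%:R.

Lemma bern_ge0 s N k : 0 <= s <= 1 -> 0 <= bern s N k.
Proof.
move=> /andP[s0 s1]; elim: N k => [|N IHN] k /=; first exact: ler0n.
rewrite addr_ge0// mulr_ge0// ?subr_ge0//.
by case: k.
Qed.

Lemma bern_gt s N k : (N < k)%N -> bern s N k = 0.
Proof.
elim: N k => [|N IHN] [|k]//= Nk.
by rewrite !IHN ?mulr0 ?addr0// ltnW.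
Qed.

(** Conditioning on the last trial; total mass, mean and variance follow from it by induction. *)
Lemma sum_bernS s N (F : nat -> R) :
  \sum_(k < N.+2) F k * bern s N.+1 k =
  (1 - s) * (\sum_(k < N.+1) F k * bern s N k) +
  s * (\sum_(k < N.+1) F k.+1 * bern s N k).
Proof.
rewrite !mulr_sumr [LHS](eq_bigr (fun k : 'I_N.+2 => (1 - s) * (F k * bern s N k) +
   s * (F k * (if (k : nat) is k'.+1 then bern s N k' else 0)))); last first.
  by move=> k _ /=; ring.
rewrite big_split/=; congr (_ + _).
  by rewrite big_ord_recr/= bern_gt// !mulr0 addr0.
by rewrite big_ord_recl/= !mulr0 add0r.
Qed.

Lemma sum_bern s N : \sum_(k < N.+1) bern s N k = 1.
Proof.
elim: N => [|N IHN]; first by rewrite big_ord1.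
rewrite (eq_bigr (fun k : 'I_N.+2 => 1 * bern s N.+1 k)) => [|k _]; last first.
  by rewrite mul1r.
rewrite (sum_bernS s N (fun=> 1)).
by under eq_bigr do rewrite mul1r; rewrite IHN; ring.
Qed.

Lemma bern_mean s N :
  \sum_(k < N.+1) ((k : nat)%:R - N%:R * s) * bern s N k = 0.
Proof.
elim: N => [|N IHN]; first by rewrite big_ord1 /= mul0r subr0 mul0r.
rewrite (sum_bernS s N (fun k => k%:R - N.+1%:R * s)).
rewrite (eq_bigr (fun k : 'I_N.+1 => ((k : nat)%:R - N%:R * s) * bern s N k
   + (- s) * bern s N k)); last by move=> k _; rewrite -[N.+1%:R]natr1; ring.
rewrite [X in _ + s * X](eq_bigr (fun k : 'I_N.+1 =>
   ((k : nat)%:R - N%:R * s) * bern s N k + (1 - s) * bern s N k)); last first.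
  by move=> k _; rewrite -[N.+1%:R]natr1 -[k.+1%:R]natr1; ring.
by rewrite !big_split/= -!mulr_sumr IHN sum_bern; ring.
Qed.

Lemma bern_variance s N :
  \sum_(k < N.+1) ((k : nat)%:R - N%:R * s) ^+ 2 * bern s N k = N%:R * (s * (1 - s)).
Proof.
elim: N => [|N IHN]; first by rewrite big_ord1 /=; ring.
rewrite (sum_bernS s N (fun k => (k%:R - N.+1%:R * s) ^+ 2)).
rewrite (eq_bigr (fun k : 'I_N.+1 => ((k : nat)%:R - N%:R * s) ^+ 2 * bern s N k
   + ((- s * 2) * (((k : nat)%:R - N%:R * s) * bern s N k)
   + s ^+ 2 * bern s N k))); last by move=> k _; rewrite -[N.+1%:R]natr1; ring.
rewrite [X in _ + s * X](eq_bigr (fun k : 'I_N.+1 =>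
   ((k : nat)%:R - N%:R * s) ^+ 2 * bern s N k
   + (((1 - s) * 2) * (((k : nat)%:R - N%:R * s) * bern s N k)
   + (1 - s) ^+ 2 * bern s N k))); last first.
  by move=> k _; rewrite -[N.+1%:R]natr1 -[k.+1%:R]natr1; ring.
rewrite !big_split/= -!mulr_sumr IHN bern_mean sum_bern -[N.+1%:R]natr1; ring.
Qed.

(** The slope of sin vanishes at pi / 2, which a may approach. Monotonicity first replaces a by b +
    d; between b and b + d, inside [-1, 1], the slope is at least cos 1. *)
Lemma sin_separation_ge (a b d : R) : - (pi / 2) <= a <= pi / 2 ->
  - 2^-1 <= b -> 0 < d -> b + d <= a -> b + d <= 1 -> cos 1 * d <= sin a - sin b.
Proof.
move=> /andP[a1 a2] b1 d0 ba bd1; have pi1 := pihalf_ge1 R.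
have h1 : sin (b + d) <= sin a.
  rewrite leNgt ltr_sin -?leNgt// in_itv/=; apply/andP; split => //; lra.
have bbd : b < b + d by rewrite ltrDl.
have [c + cE] := MVT bbd (fun s _ => is_derive_sin s)
  (continuous_subspaceT (@continuous_sin R)).
rewrite in_itv/= => /andP[c1 c2].
rewrite (_ : b + d - b = d) in cE; last by ring.
apply: (@le_trans _ _ (sin (b + d) - sin b)); last by rewrite lerB.
rewrite cE ler_wpM2r//; first exact: ltW.
have -> : cos c = cos `|c|.
  by have [c0|c0] := leP 0 c; [rewrite ger0_norm|rewrite ltr0_norm// cosN].
have cc : `|c| <= 1 by rewrite ler_norml; apply/andP; split; lra.
have pi2 := pi_ge2 R.
by rewrite leNgt ltr_cos -?leNgt// in_itv/=; apply/andP; split => //; lra.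
Qed.

Lemma sin_separation (a b d : R) : - (pi / 2) <= a <= pi / 2 ->
  `|b| <= 2^-1 -> 0 < d -> d <= 2^-1 -> d <= `|a - b| ->
  cos 1 * d <= `|sin a - sin b|.
Proof.
move=> a12; rewrite ler_norml => /andP[b1 b2] d0 d1.
have [ab|ab] := leP 0 (a - b).
  rewrite ger0_norm// => dab; apply: le_trans (ler_norm _).
  by apply: sin_separation_ge => //; lra.
rewrite ltr0_norm// => dab; rewrite -normrN opprB.
apply: le_trans (ler_norm _).
have -> : sin b - sin a = sin (- a) - sin (- b) by rewrite !sinN; lra.
by apply: sin_separation_ge => //; move/andP: a12 => []; lra.
Qed.

End bernstein.

Section trig_approximation.
Variables (R : realType) (n : nat).
Implicit Types (x y : 'rV[R]_n) (g : 'rV[R]_n -> R).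

(** Only x is confined to the ball: the interpolation nodes close to x may lie outside it. *)
Lemma uniform_on_ball g (r e : R) : continuous g -> 0 < e ->
  exists2 d, 0 < d & forall x y, `|x| <= r -> `|y - x| <= d -> `|g y - g x| <= e.
Proof.
move=> cg e0; pose K := [set x : 'rV[R]_n | `|x| <= r].
have cK : compact K.
  rewrite /K (_ : mkset _ = [set x | `|- 0 + x| <= r]).
    exact: compact_norm_ball.
  by apply/seteqP; split => x /=; rewrite oppr0 add0r.
have /compact_near_coveringP/(_ _ (0 : R)^'+
  (fun d x => forall y, `|y - x| <= d -> `|g y - g x| <= e)) := cK.
case=> [x Kx|d /= d0 dP].
  have e20 : 0 < e / 2 by rewrite divr_gt0.
  have /cvgrPdist_lt/(_ _ e20) := cg x.
  rewrite -nbhs_ballE => -[s /= s0 sP].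
  exists (ball x (s / 2), [set d | d < s / 2]) => /=.
    split; first by apply: nbhsx_ballx; rewrite divr_gt0.
    by apply: nbhs_right_lt; rewrite divr_gt0.
  move=> [x' d] /= [x'x ds] y yx'.
  have h1 : `|g x - g x'| < e / 2.
    apply: sP; move: x'x; rewrite -!ball_normE /= => x'x; apply: (lt_trans x'x).
    by rewrite ltr_pdivrMr// ltr_pMr// ltr1n.
  have h2 : `|g x - g y| < e / 2.
    apply: sP; move: x'x; rewrite -!ball_normE /= => x'x.
    have -> : x - y = (x - x') - (y - x').
      by rewrite opprB addrA subrK.
    by rewrite (le_lt_trans (ler_normB _ _))// (splitr s) ltr_leD// (le_trans yx')// ltW.
  have -> : g y - g x' = (g x - g x') - (g x - g y) by lra.
  by rewrite (le_trans (ler_normB _ _))// (splitr e) lerD// ltW.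
have d20 : 0 < d / 2 by rewrite divr_gt0.
exists (d / 2) => // x y Kx; apply: dP => //.
rewrite /ball_/= sub0r normrN gtr0_norm//.
by rewrite ltr_pdivrMr// ltr_pMr// ltr1n.
Qed.

Lemma asin_node N (k : 'I_N.+2) :
  -1 <= 2 * (k : nat)%:R / N.+1%:R - 1 :> R /\ 2 * (k : nat)%:R / N.+1%:R - 1 <= 1 :> R.
Proof.
have N0 : 0 < N.+1%:R :> R by [].
have k0 : 0 <= (k : nat)%:R :> R by [].
have kN : (k : nat)%:R <= N.+1%:R :> R by rewrite ler_nat -ltnS.
split; first by rewrite lerBrDr addrC subrr divr_ge0 ?mulr_ge0.
rewrite lerBlDr ler_pdivrMr//; lra.
Qed.

(** The weights [W] are products of binomial laws of parameters (1 + sin(x_i / T)) / 2, hence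
    trigonometric polynomials in x. Being nonnegative of sum 1, they preserve the bound B
    everywhere, even far from the ball, where periodicity prevents approximation. The arcsines place
    the node of index k near x when k / N.+1 is near its mean. *)
Theorem trig_approximation g (B r e : R) :
  continuous g -> (forall x, `|g x| <= B) -> 0 < e ->
  exists G, [/\ trig G, forall x, `|G x| <= B &
    forall x, `|x| <= r -> `|G x - g x| <= e].
Proof.
move=> cg gB e0.
have B0 : 0 <= B by exact: le_trans (normr_ge0 _) (gB 0).
have [d d0 dP] := uniform_on_ball r cg (divr_gt0 e0 (ltr0n _ 2)).
(* On the ball this gives |x_i / T| <= 1/2, and also d / T <= 1/2, as [sin_separation] requires. *)
pose T := 2 * `|r| + 2 * d + 1; have T0 : 0 < T.
  by rewrite /T; have := normr_ge0 r; lra.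
(* A node at distance at least d from x in coordinate i has frequency k / N.+1 at least eta away
   from the mean [s x i]. *)
pose eta := cos 1 * (d / T) / 2 : R.
have eta0 : 0 < eta by rewrite divr_gt0// mulr_gt0 ?cos1_gt0// divr_gt0.
(* [cheb / N.+1] is the Chebyshev bound of the total mass of the far nodes. *)
pose cheb : R := 2 * B * (n%:R / eta ^+ 2).
have cheb0 : 0 <= cheb.
  by rewrite !mulr_ge0// invr_ge0 sqr_ge0.
have [N /= NP] : exists N : nat, cheb / N.+1%:R <= e / 2.
  have : (cheb * k.+1%:R^-1) @[k --> \oo] --> (0 : R).
    by rewrite -(mulr0 cheb); apply: cvgM; [exact: cvg_cst|exact: cvg_harmonic].
  move/cvgrPdist_lt => /(_ _ (divr_gt0 e0 (ltr0n _ 2)))[k _ /(_ k (leqnn k))].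
  by rewrite /= sub0r normrN => /ltW/(le_trans (ler_norm _)) ?; exists k.
pose s (x : 'rV[R]_n) i := (1 + sin (x 0 i / T)) / 2.
have s01 x i : 0 <= s x i <= 1.
  rewrite /s; have := sin_geN1 (x 0 i / T); have := sin_le1 (x 0 i / T).
  by move=> h1 h2; apply/andP; split; lra.
pose W (ka : {ffun 'I_n -> 'I_N.+2}) x := \prod_i bern (s x i) N.+1 (ka i).
pose node (ka : {ffun 'I_n -> 'I_N.+2}) : 'rV[R]_n :=
  \row_i (T * asin (2 * (ka i : nat)%:R / N.+1%:R - 1)).
have W0 ka x : 0 <= W ka x by apply: prodr_ge0 => i _; exact: bern_ge0.
have W1 x : \sum_ka W ka x = 1.
  rewrite /W -(bigA_distr_bigA (fun i (k : 'I_N.+2) => bern (s x i) N.+1 k)).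
  by apply: big1 => i _; exact: sum_bern.
exists (fun x => \sum_ka g (node ka) * W ka x); split.
- apply: trig_sum => ka; apply: trigZ; apply: trig_prod => i.
  have ts : trig (s ^~ i).
    have := trigD (trig_cst n 2^-1)
      (trigZ 2^-1 (trig_cosw (T^-1 *: delta_mx 0 i) (- (pi / 2)))).
    congr trig; apply/funext => x; rewrite /s /cosw dotvZr dotvC dotv_delta.
    by rewrite (mulrC T^-1) cosBpihalf; field.
  suff tb M k : trig (fun x => bern (s x i) M k) by exact: tb.
  elim: M k => [|M IHM] k /=; first exact: trig_cst.
  apply: trigD; apply: trigM => //.
    have := trigD (trig_cst n 1) (trigZ (-1) ts).
    by congr trig; apply/funext => x; rewrite mulN1r.
  by case: k => [|k]; [exact: trig0|exact: IHM].
- move=> x; rewrite (le_trans (ler_norm_sum _ _ _))//.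
  apply: (@le_trans _ _ (\sum_ka B * W ka x)).
    by apply: ler_sum => ka _; rewrite normrM (ger0_norm (W0 _ _)) ler_wpM2r.
  by rewrite -mulr_sumr W1 mulr1.
move=> x xr; rewrite -[X in _ - X]mulr1 -(W1 x) mulr_sumr -sumrB.
rewrite (le_trans (ler_norm_sum _ _ _))//.
(* Chebyshev's inequality: this is at least 1 when the node is far in coordinate i, and its mean
   under [W] is a rescaled variance. *)
pose far (ka : {ffun 'I_n -> 'I_N.+2}) i : R :=
  (((ka i : nat)%:R - N.+1%:R * s x i) / (N.+1%:R * eta)) ^+ 2.
have N0 : 0 < N.+1%:R :> R by [].
have step ka : `|g (node ka) - g x| <= e / 2 + 2 * B * \sum_i far ka i.
  have far0 : 0 <= \sum_i far ka i by apply: sumr_ge0 => i _; rewrite sqr_ge0.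
  have Bfar0 : 0 <= 2 * B * \sum_i far ka i by rewrite !mulr_ge0.
  have [close|] := leP `|node ka - x| d.
    by apply: (le_trans (dP _ _ xr close)); rewrite lerDl.
  move=> dk; suff far1 : 1 <= \sum_i far ka i.
    rewrite (le_trans (ler_normB _ _))//.
    have h : 2 * B <= 2 * B * \sum_i far ka i by rewrite ler_peMr// mulr_ge0.
    by have := gB (node ka); have := gB x; lra.
  have [i di] : exists i, d <= `|(node ka - x) 0 i|.
    apply: contrapT => /forallNP nd; move: dk; rewrite ltNge => /negP; apply.
    by apply: norm_le_coord; [exact: ltW|move=> i; rewrite leNgt; apply/negP => /ltW/nd].
  rewrite (bigD1 i)//=; apply: (@le_trans _ _ (far ka i)); last first.
    by rewrite lerDl; apply: sumr_ge0 => k _; rewrite sqr_ge0.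
  have /andP aN := asin_node (ka i).
  move: di; rewrite !mxE; set a := asin _ => di.
  have sa : sin a = 2 * (ka i : nat)%:R / N.+1%:R - 1 by rewrite asinK// in_itv.
  have aI : - (pi / 2) <= a <= pi / 2 by rewrite asin_geNpi2// asin_lepi2.
  have xi : `|x 0 i / T| <= 2^-1.
    rewrite normrM normfV (gtr0_norm T0) ler_pdivrMr// (le_trans (coord_le_norm _ _))//.
    by rewrite (le_trans xr)// /T; have := ler_norm r; lra.
  have dT : d / T <= 2^-1.
    by rewrite ler_pdivrMr// /T; have := normr_ge0 r; lra.
  have dTa : d / T <= `|a - x 0 i / T|.
    rewrite ler_pdivrMr// -[X in _ * X](gtr0_norm T0) -normrM mulrBl mulfVK ?gt_eqF//.
    by rewrite (mulrC a).
  have := sin_separation aI xi (divr_gt0 d0 T0) dT dTa.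
  rewrite sa => sep; rewrite /far.
  have -> : ((ka i : nat)%:R - N.+1%:R * s x i) / (N.+1%:R * eta) =
     ((2 * (ka i : nat)%:R / N.+1%:R - 1 - sin (x 0 i / T)) / 2) / eta.
    by rewrite /s; field; rewrite !gt_eqF.
  rewrite -real_normK ?num_real// exprn_ege1// normrM normfV (gtr0_norm eta0).
  rewrite ler_pdivlMr// mul1r normrM (gtr0_norm (_ : 0 < 2^-1)) ?invr_gt0//.
  by rewrite /eta ler_pM2r// invr_gt0.
apply: (@le_trans _ _ (\sum_ka (e / 2 * W ka x +
    2 * B * \sum_i far ka i * W ka x))).
  apply: ler_sum => ka _; rewrite -mulrBl normrM (ger0_norm (W0 _ _)).
  by rewrite -mulr_suml mulrA -mulrDl; apply: ler_wpM2r.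
rewrite big_split/= -mulr_sumr W1 mulr1 -mulr_sumr exchange_big/=.
rewrite [leRHS](splitr e) lerD2l (le_trans _ NP)//.
clearbody eta.
have farE i : \sum_ka far ka i * W ka x =
    N.+1%:R * (s x i * (1 - s x i)) / (N.+1%:R * eta) ^+ 2.
  (* The mean factorizes over the coordinates: each factor other than the i-th is a total mass 1,
     and the i-th is the variance. *)
  pose q l (k : 'I_N.+2) : R := (if l == i then ((k : nat)%:R - N.+1%:R * s x i) ^+ 2
    else 1) * bern (s x l) N.+1 k.
  have -> : \sum_ka far ka i * W ka x =
      (\sum_(ka : {ffun 'I_n -> 'I_N.+2}) \prod_l q l (ka l)) / (N.+1%:R * eta) ^+ 2.
    rewrite mulr_suml; apply: eq_bigr => ka _.
    rewrite /q big_split/= -big_mkcond big_pred1_eq /far expr_div_n -/(W ka x).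
    by rewrite mulrAC.
  congr (_ / _); rewrite -(bigA_distr_bigA q) (bigD1 i)//= [X in _ * X]big1 ?mulr1.
    by rewrite /q eqxx; exact: bern_variance.
  move=> l li; rewrite -[RHS](sum_bern (s x l) N.+1); apply: eq_bigr => k _.
  by rewrite /q (negbTE li) mul1r.
have farle i : \sum_ka far ka i * W ka x <= (N.+1%:R * eta ^+ 2)^-1.
  rewrite farE exprMn ler_pdivrMr ?mulr_gt0 ?exprn_gt0//.
  rewrite (_ : _^-1 * _ = N.+1%:R); last by field; rewrite !gt_eqF.
  have /andP[s0 s1] := s01 x i; rewrite ler_piMr//.
  by rewrite mulr_ile1// ?subr_ge0// lerBlDr lerDl.
apply: (@le_trans _ _ (2 * B * \sum_(i < n) (N.+1%:R * eta ^+ 2)^-1)).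
  by rewrite ler_wpM2l ?mulr_ge0//; apply: ler_sum => i _; exact: farle.
rewrite sumr_const card_ord -[X in _ * X]mulr_natl /cheb invfM.
by rewrite le_eqVlt; apply/orP; left; apply/eqP; ring.
Qed.

End trig_approximation.

(** * Lipschitz estimate *)

Section lipschitz.
Variables (R : realType) (n : nat) (j : 'rV[R]_n -> R).
Hypothesis hj : levy_density j.
Implicit Types (x y : 'rV[R]_n) (v : 'rV[R]_n -> R).

Lemma max_over_strip (v z : 'rV[R]_n -> R) (e x1 : 'rV[R]_n) (q : R -> R) (r : R) :
  continuous v -> continuous z -> continuous q -> 0 <= r ->
  exists x2 t2, [/\ `|- x1 + x2| <= r, 0 <= t2 <= 1 &
    forall x t, `|- x1 + x| <= r -> 0 <= t <= 1 ->
      v (x + t *: e) - v x - q t - z (- x1 + x) <=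
      v (x2 + t2 *: e) - v x2 - q t2 - z (- x1 + x2)].
Proof.
move=> cv cz cq r0.
pose K := [set x | `|- x1 + x| <= r].
have cK : compact K by exact: compact_norm_ball.
have cKI := compact_setX cK (@segment_compact R 0 1).
have K1 : K x1 by rewrite /K/= addNr normr0.
pose F (p : 'rV[R]_n * R) := v (p.1 + p.2 *: e) - v p.1 - q p.2 - z (- x1 + p.1).
have cF : continuous F.
  move=> p.
  have c1 : {for p, continuous (fun p : 'rV[R]_n * R => p.1)} by exact: cvg_fst.
  have c2 : {for p, continuous (fun p : 'rV[R]_n * R => p.2)} by exact: cvg_snd.
  apply: (@continuousB _ _ _ (fun p : 'rV[R]_n * R => v (p.1 + p.2 *: e) - v p.1 - q p.2)
    (fun p => z (- x1 + p.1))).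
    apply: (@continuousB _ _ _ (fun p : 'rV[R]_n * R => v (p.1 + p.2 *: e) - v p.1)
      (fun p => q p.2)).
      apply: (@continuousB _ _ _ (fun p : 'rV[R]_n * R => v (p.1 + p.2 *: e))
        (fun p => v p.1)).
        apply: (@continuous_comp _ _ _ (fun p : 'rV[R]_n * R => p.1 + p.2 *: e) v).
          apply: (@continuousD _ _ _ (fun p : 'rV[R]_n * R => p.1)
            (fun p => p.2 *: e)); first exact: c1.
          apply: (@continuous_comp _ _ _ (fun p : 'rV[R]_n * R => p.2) (fun s => s *: e)).
            exact: c2.
          exact: scalel_continuous.
        exact: cv.
      apply: (@continuous_comp _ _ _ (fun p : 'rV[R]_n * R => p.1) v); first exact: c1.
      exact: cv.
    apply: (@continuous_comp _ _ _ (fun p : 'rV[R]_n * R => p.2) q); first exact: c2.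
    exact: cq.
  apply: (@continuous_comp _ _ _ (fun p : 'rV[R]_n * R => p.1) (fun x => z (- x1 + x))).
    exact: c1.
  exact: (continuous_addl cz).
have [|[x2 t2] /set_mem[/= x2K t2I] m] :=
    compact_EVT_max _ cKI (continuous_subspaceT cF).
  by exists (x1, 0); split => //=; rewrite in_itv/= lexx ler01.
exists x2, t2; split => //.
move=> x t xK tI; apply: (m (x, t)); rewrite inE; split => //=.
Qed.

(* Ishii-Lions: at a maximum of [v (x + t e) - v x - (A t - b t^2)], moving the
   two points symmetrically along [e] and identically for the jumps and the
   other directions gains the second derivative of the concave profile. *)
Lemma smooth_lipschitz v (C : R) (i : 'I_n) x (t : R) :
  smooth v -> (forall x, `|v x| <= C) -> (forall x, `|Lop j v x| <= C) ->
  0 <= t -> v (x + t *: delta_mx 0 i) - v x <= (3 * C + 1) * t.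
Proof.
move=> sv vC LC t0; have C0 : 0 <= C by exact: le_trans (vC 0).
have v2 a b : v a - v b <= 2 * C.
  by have := vC a; have := vC b; rewrite !ler_norml => /andP[? ?] /andP[? ?]; lra.
(* The final contradiction: the bounds on L give S >= - 2 C - 1, the concave profile gives S <= - 8
   (C + 1). *)
have contra (L1 L2 L3 S : R) : L1 + -1 * L2 + -1 * L3 <= S -> - C <= L1 -> L2 <= C ->
    L3 <= 1 -> S + 8 * (C + 1) <= 0 -> False by lra.
have [t1|t1] := leP 1 t.
  apply: le_trans (v2 _ _) _; apply: (@le_trans _ _ ((3 * C + 1) * 1)); first lra.
  by rewrite ler_wpM2l//; lra.
(* The profile is nonnegative on [0, 1] and q 1 = 2 C dominates the oscillation of v, which keeps a
   positive maximum away from t = 0 and t = 1. *)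
pose A := 3 * C + 1; pose b := C + 1; pose q (s : R) := A * s - b * s ^+ 2.
suff : v (x + t *: delta_mx 0 i) - v x <= q t.
  move=> /le_trans; apply; rewrite /q gerDl oppr_le0 mulr_ge0 ?sqr_ge0// /b; lra.
rewrite leNgt; apply/negP => vq.
have [z [r [sz [z0 zp] Lz r0 zr]]] := penalization hj (mulr_ge0 (ler0n R 2) C0) (@ltr01 R).
have [G [H c]] := sv; have [Gz [Hz cz]] := sz.
have cq : continuous q.
  move=> s; apply: continuousB; apply: continuousM => //.
  - exact: cst_continuous.
  - exact: cst_continuous.
  - exact: exprn_continuous.
pose e : 'rV[R]_n := delta_mx 0 i; rewrite -/e in vq.
have [x2 [t2 [x2r /andP[t20 t21] m]]] :=
  max_over_strip e x (C2b_cont c) (C2b_cont cz) cq r0.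
set M := v (x2 + t2 *: e) - v x2 - q t2 - z (- x + x2) in m.
have M0 : 0 < M.
  apply: (@lt_le_trans _ _ (v (x + t *: e) - v x - q t - z (- x + x))).
    by rewrite addNr z0 subr0 subr_gt0.
  by apply: m; rewrite ?addNr ?normr0// t0 ltW.
have q0 s : 0 <= s <= 1 -> 0 <= q s.
  move=> /andP[s0 s1]; have -> : q s = s * (A - b * s) by rewrite /q; ring.
  rewrite mulr_ge0// subr_ge0 (@le_trans _ _ (b * 1))//.
    by rewrite ler_wpM2l// /b; lra.
  by rewrite /A /b; lra.
have m' y s : 0 <= s <= 1 -> v (y + s *: e) - v y - q s - z (- x + y) <= M.
  move=> sI; have [yr|yr] := leP `|- x + y| r; first exact: m.
  have := zr _ yr; have := v2 (y + s *: e) y; have := q0 _ sI; lra.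
have t2p : 0 < t2.
  rewrite lt_neqAle t20 andbT; apply/eqP => t2E.
  move: M0; rewrite /M -t2E scale0r addr0 subrr /q; have := zp (- x + x2); lra.
have t2l : t2 < 1.
  rewrite lt_neqAle t21 andbT; apply/eqP => t2E.
  move: M0; rewrite /M t2E /q /A /b.
  by have := zp (- x + x2); have := v2 (x2 + 1 *: e) x2; lra.
(* First use of the maximum: t2 is frozen and both points move together. [C2b_max_Lop] disposes of
   the jumps; of the second derivatives only the i-th is kept. *)
have cPhi := C2bD (C2bD (C2b_shift (t2 *: e) c) (C2bZ (-1) c))
  (C2bZ (-1) (C2b_shift (- x) cz)).
set Phi := (fun y => _) in cPhi.
have Phim y : Phi y <= Phi x2.
  have := m' y t2; rewrite t20 t21 => /(_ isT).
  by rewrite /M /Phi (addrC y) (addrC x2); lra.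
have LPhi := C2b_max_Lop hj cPhi Phim.
have Hk k := (C2b_max cPhi Phim k).2.
have {}LPhi : Lop j Phi x2 <=
    H i i (t2 *: e + x2) + -1 * H i i x2 + -1 * Hz i i (- x + x2).
  apply: (le_trans LPhi); rewrite (bigD1 i)//= gerDl.
  by apply: sumr_le0 => k _; exact: Hk.
have LE : Lop j Phi x2 = Lop j v (t2 *: e + x2) + -1 * Lop j v x2
    + -1 * Lop j z (- x + x2).
  have s1 := smooth_shift (t2 *: e) sv; have s2 := smooth_shift (- x) sz.
  rewrite (LopD hj _ (smoothD s1 (smoothZ _ sv)) (smoothZ _ s2)).
  rewrite (LopD hj _ s1 (smoothZ _ sv)) (LopZ hj (-1) x2 sv) (LopZ hj (-1) x2 s2).
  by rewrite (Lop_shift j _ _ sv) (Lop_shift j _ _ sz).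
have [lb1 _] := andP (etrans (esym (ler_norml _ _)) (LC (t2 *: e + x2))).
have [_ ub2] := andP (etrans (esym (ler_norml _ _)) (LC x2)).
have [_ ub3] := andP (etrans (esym (ler_norml _ _)) (Lz (- x + x2))).
rewrite LE in LPhi; apply: contra LPhi lb1 ub2 ub3 _.
clear LE Hk Phim cPhi Phi Lz LC.
(* Second use: the points move apart along e, so that t changes by 2 s. The second derivatives of v
   and z are the same as before, while - q now contributes 8 b. *)
pose a s := v ((t2 *: e + x2) + (1 * s) *: e) + -1 * v (x2 + (-1 * s) *: e)
  + -1 * z ((- x + x2) + (-1 * s) *: e)
  + (b * (t2 + 2 * s) * (t2 + 2 * s) + - A * (t2 + 2 * s)).
pose a' s := 1 * G i ((t2 *: e + x2) + (1 * s) *: e)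
  + -1 * (-1 * G i (x2 + (-1 * s) *: e))
  + -1 * (-1 * Gz i ((- x + x2) + (-1 * s) *: e)) + (4 * b * (t2 + 2 * s) + - 2 * A).
have dl (s : R) : is_derive s 1 (fun s => t2 + 2 * s) 2.
  apply: (is_derive_conv _ (is_derive_addE (is_derive_cstE _ _ t2)
    (is_derive_scaleE 2 (is_derive_idE s)))); ring.
have d1 (s : R) : is_derive s 1 a (a' s).
  apply: (is_derive_conv _ (is_derive_addE (is_derive_addE (is_derive_addE
    (is_derive_on_line (t2 *: e + x2) 1 s (C2b_der1 c i))
    (is_derive_scaleE (-1) (is_derive_on_line x2 (-1) s (C2b_der1 c i))))
    (is_derive_scaleE (-1) (is_derive_on_line (- x + x2) (-1) s (C2b_der1 cz i))))
    (is_derive_addE (is_derive_mulE (is_derive_scaleE b (dl s)) (dl s))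
       (is_derive_scaleE (- A) (dl s))))).
  by rewrite /a' /e; ring.
have d2 : is_derive (0 : R) 1 a' (H i i (t2 *: e + x2) + -1 * H i i x2
    + -1 * Hz i i (- x + x2) + 8 * b).
  apply: (is_derive_conv _ (is_derive_addE (is_derive_addE (is_derive_addE
    (is_derive_scaleE 1 (is_derive_on_line (t2 *: e + x2) 1 0 (C2b_der2 c i i)))
    (is_derive_scaleE (-1) (is_derive_scaleE (-1)
       (is_derive_on_line x2 (-1) 0 (C2b_der2 c i i)))))
    (is_derive_scaleE (-1) (is_derive_scaleE (-1)
       (is_derive_on_line (- x + x2) (-1) 0 (C2b_der2 cz i i)))))
    (is_derive_addE (is_derive_scaleE (4 * b) (dl 0)) (is_derive_cstE _ _ (- 2 * A))))).
  by rewrite !mulr0 !scale0r !addr0 /e; ring.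
(* Half the distance to the ends, as t2 + 2 s must stay in [0, 1]. *)
pose d := Num.min t2 (1 - t2) / 2.
have d0 : 0 < d by rewrite divr_gt0// lt_min t2p subr_gt0.
have amax (s : R) : `|s| < d -> a s <= a 0.
  rewrite ltr_pdivlMr// lt_min => /andP[s1 s2].
  have sI : 0 <= t2 + 2 * s <= 1.
    have := ler_norm s; have := ler_norm (- s); rewrite normrN.
    by move=> ? ?; apply/andP; split; lra.
  have := m' (x2 + (-1 * s) *: e) _ sI.
  rewrite /a /M !mulr0 !scale0r !addr0 /q.
  have -> : x2 + (-1 * s) *: e + (t2 + 2 * s) *: e = t2 *: e + x2 + (1 * s) *: e.
    rewrite -addrA -scalerDl addrAC addrC; congr (_ + _).
    by rewrite -scalerDl; congr (_ *: _); ring.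
  by rewrite (addrC x2 (t2 *: e)) addrA; lra.
by have [_] := second_derivative_max d0 d1 d2 amax.
Qed.

End lipschitz.

(** * Limits of trigonometric polynomials *)

Section approximable.
Variables (R : realType) (n : nat) (j : 'rV[R]_n -> R).
Hypothesis hj : levy_density j.
Implicit Types (x y h : 'rV[R]_n) (u v w k phi : 'rV[R]_n -> R).

(* [L w = k] in the sense of limits of trigonometric polynomials: unlike the
   viscosity sense, this is obviously linear in [(w, k)]. *)
Definition approx w k : Prop := exists C : R, forall rho e : R, 0 < e ->
  exists v, [/\ trig v, forall x, `|v x| <= C, forall x, `|Lop j v x| <= C &
    forall x, `|x| <= rho -> `|v x - w x| <= e /\ `|Lop j v x - k x| <= e].

Lemma approxB_shift h w k :
  approx w k -> approx (fun x => w (h + x) - w x) (fun x => k (h + x) - k x).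
Proof.
move=> [C wC]; exists (C + C) => rho e e0.
have e20 : 0 < e / 2 by rewrite divr_gt0.
have [v [tv vC LC vw]] := wC (`|h| + `|rho|) _ e20.
have sv := trig_smooth tv; have sh := smooth_shift h sv.
have LE x : Lop j (fun x => v (h + x) - v x) x = Lop j v (h + x) - Lop j v x.
  by rewrite (LopB hj x sh sv) (Lop_shift j h x sv).
exists (fun x => v (h + x) - v x); split.
- have := trigD (trig_shift h tv) (trigZ (-1) tv).
  by congr trig; apply/funext => x; rewrite mulN1r.
- by move=> x; rewrite (le_trans (ler_normB _ _))// lerD.
- by move=> x; rewrite LE (le_trans (ler_normB _ _))// lerD.
move=> x xr.
have hx : `|h + x| <= `|h| + `|rho|.
  by rewrite (le_trans (ler_normD _ _))// lerD2l (le_trans xr)// ler_norm.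
have x' : `|x| <= `|h| + `|rho|.
  by rewrite (le_trans xr)// (le_trans (ler_norm _))// lerDr.
have [a1 a2] := vw _ hx; have [b1 b2] := vw _ x'.
have key (a b c d : R) : `|a - c| <= e / 2 -> `|b - d| <= e / 2 ->
    `|a - b - (c - d)| <= e.
  move=> ac bd; rewrite (_ : _ - _ = (a - c) - (b - d)); last by ring.
  by rewrite (le_trans (ler_normB _ _))// (splitr e) lerD.
by split; [exact: key|rewrite LE; exact: key].
Qed.

(** Replaces touching from below when w - phi attains no minimum. The penalty and its radius depend
    only on the bounds C and M, so they are chosen before the approximant v, which then has to be
    close to w on one ball only. *)
Lemma approx_touch w k phi x1 (e : R) : approx w k -> smooth phi -> 0 < e ->
  exists x2, w x2 - phi x2 <= w x1 - phi x1 + e /\ Lop j phi x2 <= k x2 + e.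
Proof.
move=> [C wC] sphi e0; have [G [H c]] := sphi; have [M phiM] := C2b_bound c.
have e20 : 0 < e / 2 by rewrite divr_gt0.
have C0 : 0 <= C.
  by have [v [_ /(_ 0) vC _ _]] := wC 0 _ e0; exact: le_trans (normr_ge0 _) vC.
have M0 : 0 <= M by exact: le_trans (normr_ge0 _) (phiM 0).
have CM : 0 <= 2 * (C + M) by rewrite mulr_ge0// addr_ge0.
have [z [r [sz [z0 zp] Lz r0 zr]]] := penalization hj CM e20.
have [v [tv vC _ vw]] := wC (`|x1| + r) _ e20.
have sv := trig_smooth tv.
have [Gv [Hv cv]] := sv; have [Gz [Hz cz]] := sz.
have cF : continuous (fun x => v x - phi x).
  move=> x; apply: continuousB; first exact: (C2b_cont cv).
  exact: (C2b_cont c).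
have FB x : `|v x - phi x| <= C + M.
  by rewrite (le_trans (ler_normB _ _))// lerD.
have [x2 [x2r Fx2 m]] := penalized_min x1 cF (C2b_cont cz) FB z0 zp r0 zr.
have xr x : `|- x1 + x| <= r -> `|x| <= `|x1| + r.
  move=> h; rewrite -[x](addKr (- x1)) opprK.
  by rewrite (le_trans (ler_normD _ _))// lerD2l.
have x1r : `|x1| <= `|x1| + r by rewrite lerDl.
have [vw2 Lvk] := vw _ (xr _ x2r); have [vw1 _] := vw _ x1r.
exists x2; split.
  move: vw2 vw1; rewrite !ler_norml => /andP[? ?] /andP[? ?]; lra.
have sz' := smooth_shift (- x1) sz.
have := Lop_max hj (smoothB (smoothB sphi sv) sz') (x := x2).
rewrite (LopB hj x2 (smoothB sphi sv) sz') (LopB hj x2 sphi sv).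
rewrite (Lop_shift j _ _ sz) => Lm.
have {}Lm : Lop j phi x2 - Lop j v x2 - Lop j z (- x1 + x2) <= 0.
  by apply: Lm => y; have := m y; lra.
have := Lz (- x1 + x2) => {}Lz.
move: Lm Lz Lvk; move: (Lop j phi x2) (Lop j v x2) (Lop j z _) => L1 L2 L3.
rewrite !ler_norml => ? /andP[? ?] /andP[? ?]; lra.
Qed.

Lemma approxN w k : approx w k -> approx (fun x => - w x) (fun x => - k x).
Proof.
move=> [C wC]; exists C => rho e e0; have [v [tv vC LC vw]] := wC rho e e0.
have sv := trig_smooth tv.
have vE : (fun x => - v x) = (fun x => -1 * v x) by apply/funext => x; rewrite mulN1r.
have LE x : Lop j (fun x => - v x) x = - Lop j v x.
  by rewrite vE (LopZ hj (-1) x sv) mulN1r.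
exists (fun x => - v x); split.
- by rewrite vE; exact: trigZ.
- by move=> x; rewrite normrN.
- by move=> x; rewrite LE normrN.
by move=> x /vw [h1 h2]; rewrite LE; split; rewrite -opprD normrN.
Qed.

Lemma approx_lipschitz_pos w k : approx w k ->
  exists2 A : R, 0 <= A &
    forall x i t, 0 <= t -> w (x + t *: delta_mx 0 i) - w x <= A * t.
Proof.
move=> [C wC].
have C0 : 0 <= C.
  have [v [_ /(_ 0) vC _ _]] := wC 0 _ (@ltr01 R).
  exact: le_trans (normr_ge0 _) vC.
exists (3 * C + 1) => [|x i t t0]; first by rewrite addr_ge0 ?mulr_ge0.
set y := x + t *: delta_mx 0 i.
apply/ler_addgt0Pr => e e0.
have e20 : 0 < e / 2 by rewrite divr_gt0.
have [v [tv vC LC vw]] := wC (`|x| + `|y|) _ e20.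
have h1 := smooth_lipschitz hj i x (trig_smooth tv) vC LC t0.
have x1 : `|x| <= `|x| + `|y| by rewrite lerDl.
have y1 : `|y| <= `|x| + `|y| by rewrite lerDr.
have [vx _] := vw x x1; have [vy _] := vw y y1.
move: h1 vx vy; rewrite -/y; clear.
by rewrite !ler_norml => ? /andP[? ?] /andP[? ?]; lra.
Qed.

Lemma approx_lipschitz w k : approx w k ->
  exists2 A : R, 0 <= A & forall x y, `|w (x + y) - w x| <= A * `|y|.
Proof.
move=> wk; have [A1 A10 L1] := approx_lipschitz_pos wk.
have [A2 A20 L2] := approx_lipschitz_pos (approxN wk).
pose A := A1 + A2; have A0 : 0 <= A by exact: addr_ge0.
have pos x i t : 0 <= t -> `|w (x + t *: delta_mx 0 i) - w x| <= A * t.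
  move=> t0; have := L1 x i t t0; have := L2 x i t t0.
  have := mulr_ge0 A10 t0; have := mulr_ge0 A20 t0; rewrite /A.
  set a := w _; set b := w x; clearbody a b; clear => ? ? ? ?.
  by rewrite ler_norml; apply/andP; split; lra.
have coord x i t : `|w (x + t *: delta_mx 0 i) - w x| <= A * `|t|.
  have [t0|t0] := leP 0 t; first by rewrite (ger0_norm t0); exact: pos.
  have := pos (x + t *: delta_mx 0 i) i (- t).
  rewrite scaleNr addrK oppr_ge0 (ltr0_norm t0) distrC; apply; exact: ltW.
exists (n%:R * A) => [|x y]; first exact: mulr_ge0.
have sumL (s : seq 'I_n) : `|w (x + \sum_(i <- s) y 0 i *: delta_mx 0 i) - w x|
    <= \sum_(i <- s) A * `|y 0 i|.
  elim: s => [|i s IHs]; first by rewrite !big_nil addr0 subrr normr0.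
  rewrite !big_cons (addrC (_ *: _)) addrA.
  set p := x + _ in IHs *.
  rewrite -(subrK (w p) (w (p + _))) -addrA (le_trans (ler_normD _ _))// lerD//.
have := sumL (index_enum 'I_n); rewrite -row_sum_delta => /le_trans; apply.
apply: (@le_trans _ _ (\sum_(i < n) A * `|y|)).
  by apply: ler_sum => i _; rewrite ler_wpM2l// coord_le_norm.
by rewrite sumr_const card_ord -[X in X <= _]mulr_natl mulrA.
Qed.

(** At a penalized maximum x2 of v, L v <= e, so v x1 <= v x2 <= M + e. *)
Lemma resolvent_le v g (M : R) : smooth v -> (forall x, v x - Lop j v x = g x) ->
  (forall x, g x <= M) -> forall x, v x <= M.
Proof.
move=> sv vg gM x1; apply/ler_addgt0Pr => e e0.
have [Gv [Hv cv]] := sv; have [B vB] := C2b_bound cv.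
have B0 : 0 <= B by exact: le_trans (normr_ge0 _) (vB 0).
have B20 : 0 <= 2 * B by rewrite mulr_ge0.
have [z [r [sz [z0 zp] Lz r0 zr]]] := penalization hj B20 e0.
have [Gz [Hz cz]] := sz.
have cF : continuous (fun x => - v x).
  by move=> x; apply: continuousN; exact: (C2b_cont cv).
have FB x : `|- v x| <= B by rewrite normrN.
have [x2 [x2r Fx2 m]] := penalized_min x1 cF (C2b_cont cz) FB z0 zp r0 zr.
have sz' := smooth_shift (- x1) sz.
have := Lop_max hj (smoothB sv sz') (x := x2).
rewrite (LopB hj x2 sv sz') (Lop_shift j _ _ sz) => Lm.
have {}Lm : Lop j v x2 - Lop j z (- x1 + x2) <= 0.
  by apply: Lm => y; have := m y; lra.
move: Lm (Lz (- x1 + x2)) (vg x2) (gM x2) Fx2.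
move: (Lop j v x2) (Lop j z _) (v x2) (v x1) (g x2); clear => L1 L2 a b c.
by rewrite ler_norml => ? /andP[? ?] ? ?; lra.
Qed.

(** With G close to u - k on a ball and v - L v = G, the functions v - z and v + z are smooth test
    functions at the penalized extrema of u - v. This gives |u - v| <= e / 2, from e / 4 for G and e
    / 4 for L z. Then L v - k = (v - u) + (u - k - G) is small too. *)
Lemma viscosity_approx u k (B : R) :
  continuous u -> continuous k -> (forall x, `|u x| <= B) -> (forall x, `|k x| <= B) ->
  (forall phi x, smooth phi -> (forall y, phi y - u y <= phi x - u x) ->
     Lop j phi x <= k x) ->
  (forall phi x, smooth phi -> (forall y, phi x - u x <= phi y - u y) ->
     k x <= Lop j phi x) ->
  approx u k.
Proof.
move=> cu ck uB kB sup sub; exists (4 * B) => rho e e0.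
have B0 : 0 <= B by exact: le_trans (normr_ge0 _) (uB 0).
(* As |u - k| <= 2 B, also |v| <= 2 B, hence |u - v| <= 3 B. *)
have B60 : 0 <= 2 * (3 * B) by rewrite !mulr_ge0.
have e40 : 0 < e / 4 by rewrite divr_gt0.
have [z [r [sz [z0 zp] Lz r0 zr]]] := penalization hj B60 e40.
have [Gz [Hz cz]] := sz.
have cg : continuous (fun x => u x - k x).
  by move=> x; apply: continuousB; [exact: cu|exact: ck].
have gB x : `|u x - k x| <= 2 * B.
  by rewrite (le_trans (ler_normB _ _))// mulrDl mul1r lerD.
have [G [tG GB Gg]] := trig_approximation (`|rho| + r) cg gB e40.
have [v [tv vG]] := trig_resolvent hj tG.
have sv := trig_smooth tv; have [Gv [Hv cv]] := sv.
have v2 x : `|v x| <= 2 * B.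
  rewrite ler_norml; apply/andP; split.
    have Nv y : -1 * v y - Lop j (fun y => -1 * v y) y = - G y.
      by rewrite (LopZ hj (-1) y sv) -vG; ring.
    have NG y : - G y <= 2 * B.
      by rewrite lerNl; have := GB y; rewrite ler_norml => /andP[].
    by rewrite lerNl -mulN1r; exact: (resolvent_le (smoothZ (-1) sv) Nv NG).
  apply: (resolvent_le sv vG) => y.
  by rewrite (le_trans (ler_norm _)).
have in_r x1 x2 : `|x1| <= rho -> `|- x1 + x2| <= r -> `|x2| <= `|rho| + r.
  move=> x1r x2r; rewrite -[x2](addKr (- x1)) opprK.
  by rewrite (le_trans (ler_normD _ _))// lerD// (le_trans x1r)// ler_norm.
have lower x : `|x| <= rho -> v x - u x <= e / 2.
  move=> xr.
  have cF : continuous (fun x => u x - v x).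
    by move=> y; apply: continuousB; [exact: cu|exact: (C2b_cont cv)].
  have FB y : `|u y - v y| <= 3 * B.
    by rewrite (le_trans (ler_normB _ _))// (_ : 3 * B = B + 2 * B) ?lerD//; ring.
  have [x2 [x2r Fx2 m]] := penalized_min x cF (C2b_cont cz) FB z0 zp r0 zr.
  have sz' := smooth_shift (- x) sz.
  have := sup _ x2 (smoothB sv sz').
  rewrite (LopB hj x2 sv sz') (Lop_shift j _ _ sz) => Lm.
  have {}Lm : Lop j v x2 - Lop j z (- x + x2) <= k x2.
    by apply: Lm => y; have := m y; clear; lra.
  move: Lm (Lz (- x + x2)) (vG x2) (Gg _ (in_r _ _ xr x2r)) Fx2.
  move: (Lop j v x2) (Lop j z _) (v x2) (v x) (G x2) (u x) (u x2) (k x2).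
  clear => L1 L2 a b c d p q.
  by rewrite !ler_norml => ? /andP[? ?] ? /andP[? ?] ?; lra.
have upper x : `|x| <= rho -> u x - v x <= e / 2.
  move=> xr.
  have cF : continuous (fun x => v x - u x).
    by move=> y; apply: continuousB; [exact: (C2b_cont cv)|exact: cu].
  have FB y : `|v y - u y| <= 3 * B.
    by rewrite (le_trans (ler_normB _ _))// (_ : 3 * B = 2 * B + B) ?lerD//; ring.
  have [x2 [x2r Fx2 m]] := penalized_min x cF (C2b_cont cz) FB z0 zp r0 zr.
  have sz' := smooth_shift (- x) sz.
  have := sub _ x2 (smoothD sv sz').
  rewrite (LopD hj x2 sv sz') (Lop_shift j _ _ sz) => Lm.
  have {}Lm : k x2 <= Lop j v x2 + Lop j z (- x + x2).
    by apply: Lm => y; have := m y; clear; lra.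
  move: Lm (Lz (- x + x2)) (vG x2) (Gg _ (in_r _ _ xr x2r)) Fx2.
  move: (Lop j v x2) (Lop j z _) (v x2) (v x) (G x2) (u x) (u x2) (k x2).
  clear => L1 L2 a b c d p q.
  by rewrite !ler_norml => ? /andP[? ?] ? /andP[? ?] ?; lra.
exists v; split => //.
- by move=> x; rewrite (le_trans (v2 x))// ler_wpM2r// ler_nat.
- move=> x; have -> : Lop j v x = v x - G x.
    by rewrite -vG; move: (Lop j v x) => L; ring.
  by rewrite (le_trans (ler_normB _ _))// (_ : 4 * B = 2 * B + 2 * B) ?lerD//; ring.
move=> x xr; have := upper x xr; have := lower x xr; have := vG x.
have := Gg x (in_r x x xr _); rewrite addNr normr0 => /(_ r0).
move: e0; move: (Lop j v x) (v x) (G x) (u x) (k x); clear => L1 a b c d.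
by rewrite !ler_norml => ? /andP[? ?] ? ? ?; split; apply/andP; split; lra.
Qed.

End approximable.

(** * Maximum principles *)

Section maximum_principles.
Variables (R : realType) (n : nat) (j : 'rV[R]_n -> R).
Hypothesis hj : levy_density j.
Implicit Types (x y : 'rV[R]_n) (w k : 'rV[R]_n -> R).

Lemma weak_max_principle w k (c B : R) : approx j w k -> 0 < c ->
  (forall x, - B <= w x) -> (forall x, w x < 0 -> k x <= c * w x) ->
  forall x, 0 <= w x.
Proof.
move=> wk c0 wB kw x0; rewrite leNgt; apply/negP => wx0.
have hi : has_inf (range w).
  by split; [exists (w x0), x0|exists (- B) => _ [x _ <-]; exact: wB].
pose m := inf (range w).
have m0 : m < 0.
  by apply: le_lt_trans wx0; apply: inf_lbound; [exact: hi.2|exists x0].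
(* Touching by the constant 0 near the infimum gives a point with w <= m + 2 e <= m / 2 and k >= -
   e, against k <= c w <= c m / 2 < - e. *)
pose e := Num.min (- m / 4) (c * - m / 4).
have e0 : 0 < e by rewrite lt_min !divr_gt0// ?mulr_gt0// oppr_gt0.
have e1 : e <= - m / 4 by rewrite ge_min lexx.
have e2 : e <= c * - m / 4 by rewrite ge_min lexx orbT.
have [_ [x1 _ <-] wx1] := inf_adherent e0 hi.
have [x2 [wx2 Lx2]] := approx_touch hj x1 wk (smooth_cst n 0) e0.
rewrite (Lop_cst hj) in Lx2.
have wx2' : w x2 <= m / 2.
  move: wx2 wx1 e1; rewrite -/m; clear; lra.
have wx20 : w x2 < 0 by move: wx2' m0; clear; lra.
have := ler_wpM2l (ltW c0) wx2'; have := kw _ wx20.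
have := mulr_gt0 c0 (_ : 0 < - m); rewrite oppr_gt0 => /(_ m0).
move: Lx2 e2; clear; lra.
Qed.

Lemma levy_int_weight_ge0 : 0 <= levy_int j (@levy_weight R n).
Proof.
have aw := @levy_weight_admissible R n.
have := levy_int_abs hj aw aw; move=> /(_ (fun y => _))/(le_trans (normr_ge0 _)).
by apply=> y; rewrite ger0_norm// levy_weight_ge0.
Qed.

(* Quantitative form: the barrier is a Gaussian centred at [x1], a strict
   subsolution outside the ball around [x1] where [w] stays above [eta / 2]. *)
Lemma strong_max_principle (A Lam eta r : R) :
  0 <= A -> 0 <= Lam -> 0 < eta -> 0 <= r ->
  exists2 e : R, 0 < e & forall w k, approx j w k -> (forall x, 0 <= w x) ->
    (forall x y, `|w (x + y) - w x| <= A * `|y|) ->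
    (forall x, k x <= Lam * w x) ->
    forall x1 y, eta <= w x1 -> `|y| <= r -> e <= w (x1 + y).
Proof.
move=> A0 Lam0 eta0 r0.
(* Within distance s of x1, w stays above eta - A s >= eta / 2. *)
pose s := eta / (2 * (A + 1)).
have A1 : 0 < 2 * (A + 1) by rewrite mulr_gt0// ltr_wpDl.
have s0 : 0 < s by rewrite divr_gt0.
have s20 : 0 < 4 * s ^+ 2 by rewrite mulr_gt0// exprn_gt0.
have As : A * s <= eta / 2.
  rewrite /s mulrA ler_pdivrMr// (_ : eta / 2 * _ = eta * A + eta); last by field.
  by rewrite (mulrC A) lerDl ltW.
pose J := levy_int j (@levy_weight R n); have J0 : 0 <= J := levy_int_weight_ge0.
(* Since a >= 1, the leading term 4 a^2 |x|^2 >= a Q of [Lop_gauss_ge] absorbs all others and leaves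
   Lam + 1. *)
pose Q := 2 * n%:R + 2 * J + Lam + 1.
have Q0 : 0 <= Q by rewrite /Q !addr_ge0// mulr_ge0.
pose a := 1 + Q / (4 * s ^+ 2).
have a1 : 1 <= a by rewrite lerDl divr_ge0// ltW.
have a0 : 0 < a by exact: lt_le_trans a1.
have aQ : Q <= 4 * a * s ^+ 2.
  rewrite /a (_ : 4 * _ * _ = 4 * s ^+ 2 + Q); last by field; rewrite gt_eqF.
  by rewrite lerDr ltW.
(* [rr] bounds the squared Euclidean norm on the sup-norm ball of radius r. Subtracting c0 makes the
   barrier negative far away, yet positive, by at least e below, on that ball. *)
pose rr := n%:R * r ^+ 2; pose c0 := expR (- a * (rr + 1)).
have c00 : 0 < c0 by exact: expR_gt0.
pose d := eta / 4; have d0 : 0 < d by rewrite divr_gt0.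
have sub x : s < `|x| -> (Lam + 1) * gauss a x <= Lop j (gauss a) x.
  move=> sx; apply: le_trans (Lop_gauss_ge hj x (ltW a0)).
  rewrite ler_wpM2r//; first by rewrite ltW// gauss_gt0.
  have h1 : s ^+ 2 <= dotv x x.
    rewrite (le_trans _ (sqr_norm_le_dotv x))// ler_sqr ?nnegrE//; exact: ltW.
  have h2 : a * Q <= a * (4 * a * dotv x x).
    rewrite ler_wpM2l//; first exact: ltW.
    by rewrite (le_trans aQ)// ler_wpM2l// mulr_ge0// ltW.
  have h3 : 0 <= (a - 1) * J by rewrite mulr_ge0// subr_ge0.
  have h4 : 0 <= (a - 1) * Lam by rewrite mulr_ge0// subr_ge0.
  move: h2 h3 h4 a1; rewrite -/J /Q; clearbody J a; clear => ? ? ? ?; lra.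
pose e := d * (expR (- a * rr) - c0).
have e0 : 0 < e.
  rewrite mulr_gt0// subr_gt0 ltr_expR !mulNr ltrN2.
  by rewrite ltr_pM2l// ltrDl.
exists e => // w k wk w0 wA kw x1 y wx1 yr.
pose phi x := d * gauss a (- x1 + x) + - (d * c0).
have sg := smooth_gauss n (ltW a0).
have sg1 := smooth_shift (- x1) sg.
have sphi : smooth phi by apply: smoothD; [exact: smoothZ|exact: smooth_cst].
have Lphi x : Lop j phi x = d * Lop j (gauss a) (- x1 + x).
  rewrite (LopD hj x (smoothZ d sg1) (smooth_cst n _)) (Lop_cst hj) addr0.
  by rewrite (LopZ hj d x sg1) (Lop_shift j _ _ sg).
have phiw x : phi x <= w x.
  rewrite leNgt; apply/negP => wphi.
  (* The first bound keeps w < phi at the touching point; the second is smaller than the gain d c0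
     of the strict subsolution. *)
  pose t := Num.min ((phi x - w x) / 2) (d * c0 / 2).
  have t0 : 0 < t by rewrite lt_min !divr_gt0 ?mulr_gt0// subr_gt0.
  have t1 : t <= (phi x - w x) / 2 by rewrite ge_min lexx.
  have t2 : t <= d * c0 / 2 by rewrite ge_min lexx orbT.
  have [x2 [wx2 Lx2]] := approx_touch hj x wk sphi t0.
  have {}wx2 : w x2 < phi x2 by move: wx2 t1 wphi; clear; lra.
  have cE : c0 < gauss a (- x1 + x2).
    have := le_lt_trans (w0 x2) wx2; rewrite /phi -mulrN -mulrDr.
    by rewrite pmulr_rgt0// subr_gt0.
  have E1 : gauss a (- x1 + x2) <= 1 by rewrite gauss_le1// ltW.
  (* In the ball of radius s, w >= eta / 2 while phi < d = eta / 4. *)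
  have sx : s < `|- x1 + x2|.
    rewrite ltNge; apply/negP => sx.
    have := wA x1 (- x1 + x2); rewrite addrA subrr add0r ler_norml => /andP[h _].
    have h2 := ler_wpM2l A0 sx.
    have h3 : d * gauss a (- x1 + x2) <= d by rewrite ler_piMr// ltW.
    have h4 : 0 < d * c0 by rewrite mulr_gt0.
    move: wx2 h h2 h3 h4 As wx1 eta0; rewrite /phi /d.
    move: (w x2) (w x1) (gauss _ _) (A * s) (A * _) => p q g A2 A3; clear; lra.
  have := sub _ sx => /(ler_wpM2l (ltW d0)); rewrite -Lphi => h1.
  have h2 := le_trans h1 Lx2; have h3 := kw x2.
  have h4 := ler_wpM2l Lam0 (ltW wx2).
  have h5 : d * c0 < d * gauss a (- x1 + x2) by rewrite ltr_pM2l.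
  have h6 : 0 <= Lam * (d * c0) by rewrite !mulr_ge0// ltW.
  have h7 : 0 < d * c0 by rewrite mulr_gt0.
  move: h2 h3 h4 h5 h6 h7 t2; rewrite /phi.
  move: (k x2) (w x2) (gauss _ _) => K W g; clear; clearbody d c0 t.
  rewrite (_ : d * ((Lam + 1) * g) = Lam * (d * g) + d * g); last by ring.
  rewrite mulrDr mulrN; lra.
apply: le_trans (phiw (x1 + y)); rewrite /phi addKr /e mulrBr lerD2r.
rewrite (ler_pM2l d0) /gauss ler_expR !mulNr lerN2 (ler_pM2l a0).
by rewrite (le_trans (dotv_le_sqr_norm y))// /rr ler_wpM2l// ler_sqr ?nnegrE.
Qed.

End maximum_principles.

(** * Sliding *)

Section sliding.
Variables (R : realType) (n : nat) (j : 'rV[R]_n.+1 -> R).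
Hypothesis hj : levy_density j.
Implicit Types (x y z nu : 'rV[R]_n.+1) (a b t : R).
Variables (f : R -> R) (u : 'rV[R]_n.+1 -> R) (A B Lam delta c M : R).
Hypotheses (A0 : 0 <= A) (Lam0 : 0 <= Lam) (delta1 : delta <= 2^-1) (c0 : 0 < c).
Hypothesis M0 : 0 <= M.
Hypothesis uf : approx j u (fun x => f (u x)).
Hypothesis uB : forall x, `|u x| <= B.
Hypothesis uA : forall x y, `|u (x + y) - u x| <= A * `|y|.
Hypothesis fLam : forall a b, `|a| <= B -> `|b| <= B -> a <= b ->
  f b - f a <= Lam * (b - a).
Hypothesis fc : forall a b, a < b -> 1 - delta <= a \/ b <= - 1 + delta ->
  f a - f b <= c * (a - b).
Hypothesis u_top : forall x, M <= x 0 ord_max -> 1 - delta <= u x.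
Hypothesis u_bot : forall x, x 0 ord_max <= - M -> u x <= - 1 + delta.

(** The weak maximum principle needs [fc] wherever the shifted function is smaller: above the strip
    the shifted value is near or beyond 1, below it the unshifted one is near or beyond -1, and
    inside the hypothesis decides. *)
Lemma slide_outside nu t : 0 <= t -> 0 <= nu 0 ord_max ->
  (forall x, - M <= x 0 ord_max <= M ->
     u x <= u (t *: nu + x) \/ 1 - delta <= u (t *: nu + x)) ->
  forall x, u x <= u (t *: nu + x).
Proof.
move=> t0 nu0 strip x; rewrite -subr_ge0.
have bd y : - (2 * B) <= u (t *: nu + y) - u y.
  have := uB (t *: nu + y); have := uB y; rewrite !ler_norml.
  by move=> /andP[? ?] /andP[? ?]; lra.
apply: (@weak_max_principle _ _ j hj (fun x => u (t *: nu + x) - u x) _ c (2 * B)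
  (approxB_shift hj (t *: nu) uf) c0 bd _ x) => y.
rewrite subr_lt0 => uy; apply: fc => //.
have [yM|yM] := leP M (y 0 ord_max).
  left; apply: u_top; rewrite !mxE (le_trans yM)// lerDr mulr_ge0//.
have [yM'|yM'] := leP (y 0 ord_max) (- M); first by right; exact: u_bot.
have yI : - M <= y 0 ord_max <= M by rewrite !ltW.
by case: (strip y yI) => [|]; [rewrite leNgt uy|left].
Qed.

(** The shift by t nu cannot leave u almost unchanged all along a line crossing the strip; a
    definite gain at one point of the line is carried to x by [strong_max_principle]. The number of
    steps depends on K and not on x, so e is uniform. *)
Lemma slide_strict nu t (K : R) : 0 < t -> 0 < nu 0 ord_max ->
  (forall x, u x <= u (t *: nu + x)) ->
  exists2 e : R, 0 < e &
    forall x, `|x 0 ord_max| <= K -> e <= u (t *: nu + x) - u x.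
Proof.
move=> t0 nu0 mono.
have tn0 : 0 < t * nu 0 ord_max by rewrite mulr_gt0.
have [N NK] : exists N : nat, M + `|K| <= N.+1%:R * (t * nu 0 ord_max).
  pose q := (M + `|K|) / (t * nu 0 ord_max).
  have q0 : 0 <= q by rewrite divr_ge0 ?addr_ge0// ltW.
  exists (Num.bound q); rewrite -ler_pdivrMr// (le_trans (ltW (archi_boundP q0)))//.
  by rewrite ler_nat.
pose N1 := N.+1.
have N0 : 0 < 2 * N1%:R :> R by rewrite mulr_gt0.
(* As delta <= 1/2, u rises by at least 1 over 2 N1 steps, so some step gains eta. *)
pose eta : R := (2 * N1%:R)^-1; have eta0 : 0 < eta by rewrite invr_gt0.
have AA0 : 0 <= A + A by rewrite addr_ge0.
have r0 : 0 <= N1%:R * `|t *: nu| by rewrite mulr_ge0.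
have [e e0 smp] := strong_max_principle hj AA0 Lam0 eta0 r0.
exists e => // x xK.
pose p (i : nat) := (i%:R - N1%:R) *: (t *: nu) + x.
have pS i : t *: nu + p i = p i.+1.
  rewrite /p addrA -[i.+1%:R]natr1 -{1}[t *: nu]scale1r -scalerDl.
  by congr (_ *: _ + _); ring.
have pmax i : p i 0 ord_max = (i%:R - N1%:R) * (t * nu 0 ord_max) + x 0 ord_max.
  by rewrite !mxE.
have xx : - `|K| <= x 0 ord_max <= `|K|.
  by rewrite -ler_norml (le_trans xK)// ler_norm.
have top : 1 - delta <= u (p (2 * N1)%N).
  apply: u_top; rewrite pmax natrM (_ : 2 * _ - _ = N1%:R); last by ring.
  by move/andP: xx NK => [? ?] ?; rewrite /N1; lra.
have bot : u (p 0%N) <= - 1 + delta.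
  apply: u_bot; rewrite pmax sub0r mulNr.
  by move/andP: xx NK => [? ?] ?; rewrite /N1; lra.
have [i iN etai] : exists2 i, (i < 2 * N1)%N & eta <= u (t *: nu + p i) - u (p i).
  apply: contrapT => no.
  have := telescope_sumr (fun i => u (p i)) (leq0n (2 * N1)).
  apply/eqP; rewrite lt_eqF//.
  apply: (@lt_le_trans _ _ (\sum_(0 <= i < 2 * N1) eta)); last first.
    rewrite sumr_const_nat subn0 -[X in X <= _]mulr_natl natrM mulfV ?gt_eqF//.
    move: (u _) (u _) top bot delta1 => p1 p2.
    by lra.
  apply: ltr_sum_nat => // i /andP[_ iN].
  by rewrite -pS ltNge; apply/negP => h; apply: no; exists i.
have x_p : x = p i + - ((i%:R - N1%:R) *: (t *: nu)) by rewrite /p addrAC subrr add0r.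
have py : `|- ((i%:R - N1%:R) *: (t *: nu))| <= N1%:R * `|t *: nu|.
  rewrite normrN normrZ ler_wpM2r// ler_norml.
  have i0 : 0 <= i%:R :> R by [].
  have : i%:R <= 2 * N1%:R :> R by rewrite -natrM ler_nat ltnW.
  by move=> ?; apply/andP; split; lra.
rewrite [X in u (_ + X) - u X]x_p.
apply: (smp _ _ (approxB_shift hj (t *: nu) uf)) etai py.
- by move=> y; rewrite subr_ge0.
- move=> y z; rewrite addrA.
  rewrite (_ : _ - _ - (_ - _) =
      (u (t *: nu + y + z) - u (t *: nu + y)) - (u (y + z) - u y)).
    by rewrite (le_trans (ler_normB _ _))// mulrDl lerD.
  by ring.
by move=> y; apply: fLam.
Qed.

Lemma slide nu t : 0 < nu 0 ord_max -> 0 <= t -> forall x, u x <= u (t *: nu + x).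
Proof.
move=> nu0 t0 x0; rewrite leNgt; apply/negP => ux0.
pose S := [set t | 0 <= t /\ exists x, u (t *: nu + x) < u x].
(* Such a shift carries the whole strip above height M. *)
have far s : 2 * M <= s * nu 0 ord_max -> 0 <= s -> forall x, u x <= u (s *: nu + x).
  move=> sM s0; apply: slide_outside => //; first exact: ltW.
  by move=> x /andP[x1 x2]; right; apply: u_top; rewrite !mxE; lra.
have hS : has_sup S.
  split; first by exists t; split => //; exists x0.
  exists (2 * M / nu 0 ord_max) => s [s0 [x us]].
  rewrite ler_pdivlMr// leNgt; apply/negP => sM.
  by move: us; rewrite ltNge (far s (ltW sM) s0).
pose ts := sup S.
have above s : ts < s -> forall x, u x <= u (s *: nu + x).
  move=> tss x; rewrite leNgt; apply/negP => us.
  have : s <= ts by apply: sup_ubound; [exact: hS.2|split; [|by exists x]];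
    rewrite (le_trans _ (ltW tss))// (le_trans t0)//; apply: sup_ubound;
    [exact: hS.2|split => //; exists x0].
  by rewrite leNgt tss.
have tts : t <= ts by apply: sup_ubound; [exact: hS.2|split => //; exists x0].
have t_gt0 : 0 < t.
  rewrite lt_neqAle t0 andbT; apply/eqP => t0E.
  by move: ux0; rewrite -t0E scale0r add0r ltxx.
have ts0 : 0 < ts by exact: lt_le_trans tts.
have An0 : 0 < A * `|nu| + 1 by rewrite ltr_wpDl// mulr_ge0.
have shiftA s s' x : u (s' *: nu + x) - A * (`|s - s'| * `|nu|) <= u (s *: nu + x).
  have := uA (s' *: nu + x) ((s - s') *: nu); rewrite normrZ.
  have -> : s' *: nu + x + (s - s') *: nu = s *: nu + x.
    by rewrite addrAC -scalerDl addrCA subrr addr0.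
  rewrite ler_norml => /andP[h _]; lra.
have at_ts x : u x <= u (ts *: nu + x).
  apply/ler_addgt0Pr => e e0.
  pose s := ts + e / (A * `|nu| + 1).
  have d0 : 0 < e / (A * `|nu| + 1) by rewrite divr_gt0.
  have ss : ts < s by rewrite ltrDl.
  have := shiftA ts s x; have := above s ss x.
  rewrite (_ : ts - s = - (e / (A * `|nu| + 1))); last by rewrite /s; ring.
  rewrite normrN (gtr0_norm d0).
  have : A * (e / (A * `|nu| + 1) * `|nu|) <= e.
    rewrite (_ : A * _ = e * (A * `|nu|) / (A * `|nu| + 1)); last by ring.
    by rewrite ler_pdivrMr// ler_pM2l// lerDl.
  by lra.
have [e e0 eP] := slide_strict M ts0 nu0 at_ts.
(* For s within d of ts the Lipschitz loss is at most the gain e on the strip, so s is good as well,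
   although the supremum has bad parameters arbitrarily close. *)
pose d := Num.min ts (e / (A * `|nu| + 1)).
have d0 : 0 < d by rewrite lt_min ts0 divr_gt0.
have [s [s0 [x us]] ds] := sup_adherent d0 hS.
rewrite -/ts in ds.
have sts : s <= ts by apply: sup_ubound; [exact: hS.2|split => //; exists x].
move: us; rewrite ltNge => /negP; apply; apply: slide_outside => //; first exact: ltW.
move=> y yM; left.
have := eP y; rewrite ler_norml => /(_ yM) ey.
have := shiftA s ts y.
rewrite (ler0_norm (_ : s - ts <= 0)) ?subr_le0//.
have h : A * (- (s - ts) * `|nu|) <= e.
  have de : d <= e / (A * `|nu| + 1) by rewrite ge_min lexx orbT.
  have sd : - (s - ts) <= e / (A * `|nu| + 1) by move: ds de; lra.
  apply: (@le_trans _ _ (A * (e / (A * `|nu| + 1) * `|nu|))).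
    by rewrite ler_wpM2l// ler_wpM2r.
  rewrite (_ : A * _ = e * (A * `|nu|) / (A * `|nu| + 1)); last by ring.
  by rewrite ler_pdivrMr// ler_pM2l// lerDl.
by move: h ey; lra.
Qed.

Lemma slide_horizontal (h : 'rV[R]_n.+1) x : h 0 ord_max = 0 -> u x <= u (h + x).
Proof.
move=> h0; apply/ler_addgt0Pr => e e0.
pose d := e / (A + 1).
have A1 : 0 < A + 1 by rewrite ltr_wpDl.
have d0 : 0 < d by rewrite divr_gt0.
pose nu : 'rV[R]_n.+1 := h + d *: delta_mx 0 ord_max.
have nu0 : 0 < nu 0 ord_max by rewrite !mxE !eqxx h0 add0r mulr1.
have := slide nu0 ler01 x; rewrite scale1r.
have := uA (h + x) (d *: delta_mx 0 ord_max).
rewrite addrAC -/nu normrZ (gtr0_norm d0).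
have d1 : `|delta_mx 0 ord_max : 'rV[R]_n.+1| <= 1.
  apply: norm_le_coord => // i; rewrite !mxE eqxx/=.
  by case: (_ == _); rewrite ?normr1 ?normr0.
have : A * (d * `|delta_mx 0 ord_max : 'rV[R]_n.+1|) <= e.
  apply: (@le_trans _ _ (A * (d * 1))); first by rewrite ler_wpM2l// ler_pM2l.
  rewrite mulr1 /d mulrA ler_pdivrMr// mulrDr mulr1 (mulrC A) lerDl; exact: ltW.
rewrite ler_norml => ? /andP[? ?] ?; lra.
Qed.

Lemma slide_symmetry : exists u0 : R -> R, {homo u0 : s t / s < t} /\
  forall (y : 'rV[R]_n) t, u (rV_rcons y t) = u0 t.
Proof.
exists (fun t => u (rV_rcons 0 t)); split.
  move=> s t st /=.
  pose e : 'rV[R]_n.+1 := delta_mx 0 ord_max.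
  have e1 : 0 < e 0 ord_max by rewrite mxE !eqxx.
  have ts0 : 0 < t - s by rewrite subr_gt0.
  have [d d0 dP] := slide_strict `|s| ts0 e1 (slide e1 (ltW ts0)).
  have := dP (rV_rcons 0 s); rewrite rV_rcons_max => /(_ (lexx _)).
  have -> : (t - s) *: e + rV_rcons 0 s = rV_rcons 0 t.
    apply/rowP => i; rewrite !mxE eqxx/=.
    case: unliftP => [k|] ->; rewrite /= ?eqxx/= ?mulr1 ?subrK//.
    by rewrite mxE eq_sym (negbTE (neq_lift _ _)) mulr0 addr0.
  by lra.
move=> y t.
pose h : 'rV[R]_n.+1 := rV_rcons y t - rV_rcons 0 t.
have h0 : h 0 ord_max = 0 by rewrite !mxE unlift_none subrr.
have hE : h + rV_rcons 0 t = rV_rcons y t by rewrite subrK.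
apply/eqP; rewrite eq_le -{2}hE slide_horizontal// andbT.
have -> : rV_rcons 0 t = - h + rV_rcons y t by rewrite opprB subrK.
by rewrite slide_horizontal// mxE h0 oppr0.
Qed.

End sliding.

(** * From viscosity solutions to the theorem *)

Section viscosity_touching.
Variables (R : realType) (n : nat) (j : 'rV[R]_n -> R).
Hypothesis hj : levy_density j.
Implicit Types (x y : 'rV[R]_n) (u k phi : 'rV[R]_n -> R).

Lemma patch_setT (u phi : 'rV[R]_n -> R) : patch u setT phi = phi.
Proof. by apply/funext => x; rewrite /patch mem_set. Qed.

Lemma smooth_closure phi : smooth phi -> C2_closure setT phi.
Proof. by move=> [G [H c]]; exact: C2b_closure c. Qed.

Lemma Lop_addcst phi a x : smooth phi -> Lop j (fun y => phi y + a) x = Lop j phi x.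
Proof.
by move=> s; rewrite (LopD hj x s (smooth_cst n a)) (Lop_cst hj) addr0.
Qed.

(** With the whole space as neighbourhood the patched function is the test function itself, and
    adding a constant, which L ignores, makes it touch u at x. *)
Lemma supersolution_touch u k phi x : viscosity_supersolution j setT u k ->
  smooth phi -> (forall y, phi y - u y <= phi x - u x) -> Lop j phi x <= k x.
Proof.
move=> [_ _ _ vs] s m.
have s' : smooth (fun y => phi y + (u x - phi x)).
  by apply: smoothD => //; exact: smooth_cst.
have := vs x setT _ I openT I (subset_refl _) (smooth_closure s').
rewrite patch_setT (levy_opE hj x s') lee_fin Lop_addcst//; apply => //; first by ring.
by move=> y _; have := m y; lra.
Qed.

Lemma subsolution_touch u k phi x : viscosity_subsolution j setT u k ->
  smooth phi -> (forall y, phi x - u x <= phi y - u y) -> k x <= Lop j phi x.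
Proof.
move=> [_ _ _ vs] s m.
have s' : smooth (fun y => phi y + (u x - phi x)).
  by apply: smoothD => //; exact: smooth_cst.
have := vs x setT _ I openT I (subset_refl _) (smooth_closure s').
rewrite patch_setT (levy_opE hj x s') lee_fin Lop_addcst//; apply => //; first by ring.
by move=> y _; have := m y; lra.
Qed.

End viscosity_touching.

(** * Increments of the nonlinearity *)

Section nonlinearity.
Variables (R : realType) (f : R -> R).
Hypothesis f1 : C1_fun f.

Lemma C1_is_derive (r : R) : is_derive r 1 f (derive1 f r).
Proof. by rewrite derive1E; apply: derivableP; exact: f1.1. Qed.

Lemma C1_MVT a b : a < b ->
  exists2 c, a < c < b & f b - f a = derive1 f c * (b - a).
Proof.
move=> ab; have [c cab fE] := MVT ab (fun r _ => C1_is_derive r)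
  (continuous_subspaceT (derive_continuous C1_is_derive)).
by exists c => //; move: cab; rewrite in_itv.
Qed.

Lemma C1_increment_le (B : R) : 0 <= B -> exists2 Lam : R, 0 <= Lam &
  forall a b, `|a| <= B -> `|b| <= B -> a <= b -> f b - f a <= Lam * (b - a).
Proof.
move=> B0; have BB : - B <= B by lra.
have [m _ mP] := EVT_max BB (continuous_subspaceT f1.2).
exists `|derive1 f m| => // a b aB bB; rewrite le_eqVlt => /predU1P[->|ab].
  by rewrite !subrr mulr0.
have [r /andP[ar rb] ->] := C1_MVT ab.
rewrite ler_wpM2r//; first by rewrite subr_ge0 ltW.
rewrite (le_trans _ (ler_norm _))// mP// in_itv/=.
move: aB bB; rewrite !ler_norml => /andP[? ?] /andP[? ?].
by apply/andP; split; lra.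
Qed.

(** Continuity of f' at 1 and -1 extends the lower bound slightly inside; halving the infimum leaves
    room for this. One end is enough: since a < b, either alternative puts the whole segment where
    f' > c. *)
Lemma C1_strong_monotone :
  (0 < ereal_inf [set (derive1 f r)%:E | r in [set r : R | (1 <= `|r|)%R]])%E ->
  exists delta c : R, [/\ 0 < delta, delta <= 2^-1, 0 < c &
    forall a b, a < b -> 1 - delta <= a \/ b <= - 1 + delta ->
      f a - f b <= c * (a - b)].
Proof.
set I := ereal_inf _ => I0.
have If r : 1 <= `|r| -> (I <= (derive1 f r)%:E)%E.
  by move=> r1; apply: ereal_inf_lbound; exists r.
have I1 : I \is a fin_num.
  rewrite ge0_fin_numE ?(ltW I0)//; apply: le_lt_trans (If 1 _) (ltry _).
  by rewrite normr1.
pose c := fine I / 2.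
have c0 : 0 < c.
  by rewrite divr_gt0// -lte_fin fineK.
have cf r : 1 <= `|r| -> 2 * c <= derive1 f r.
  by move=> r1; have := If r r1; rewrite -{1}(fineK I1) lee_fin /c; lra.
have near1 r0 : 1 <= `|r0| ->
    exists2 d, 0 < d & forall r, `|r0 - r| < d -> c < derive1 f r.
  move=> r01; have /cvgrPdist_lt/(_ _ c0) := f1.2 r0.
  rewrite -nbhs_ballE => -[d /= d0 dP]; exists d => // r rd.
  have := dP r; rewrite -ball_normE /= => /(_ rd).
  by rewrite ltr_norml => /andP[_ h]; have := cf _ r01; lra.
have n1 : 1 <= `|1 : R| by rewrite normr1.
have n2 : 1 <= `|-1 : R| by rewrite normrN1.
have [d1 d10 d1P] := near1 _ n1; have [d2 d20 d2P] := near1 _ n2.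
pose d := Num.min 2^-1 (Num.min d1 d2).
have dd1 : d <= d1 by rewrite !ge_min lexx !orbT.
have dd2 : d <= d2 by rewrite !ge_min lexx !orbT.
have dh : d <= 2^-1 by rewrite ge_min lexx.
exists d, c; split => //; first by rewrite !lt_min d10 d20 invr_gt0 ltr0n.
move=> a b ab side; have [r /andP[ar rb] fE] := C1_MVT ab.
have ba : 0 < b - a by rewrite subr_gt0.
suff cr : c <= derive1 f r by have := ler_wpM2r (ltW ba) cr; lra.
case: side => side.
  have [r1|r1] := leP 1 r.
    by have := cf r; rewrite ger0_norm ?(le_trans ler01)// => /(_ r1); lra.
  by apply/ltW/d1P; rewrite gtr0_norm; lra.
have [r1|r1] := leP r (-1).
  have := cf r; rewrite ler0_norm; last by lra.
  by rewrite lerNr => /(_ r1); lra.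
by apply/ltW/d2P; rewrite ltr0_norm; lra.
Qed.

End nonlinearity.

(** * The uniform limits at infinity as bounds on half-spaces *)

Section uniform_limits.
Variables (R : realType) (n : nat) (u : 'rV[R]_n.+1 -> R).

Lemma rcons_unrcons (x : 'rV[R]_n.+1) :
  rV_rcons (rV_unrcons x).1 (x 0 ord_max) = x.
Proof. exact: rV_unrconsK x. Qed.

Lemma uniform_near (F : set_system R) (l e : R) : Filter F -> 0 < e ->
  {uniform, (fun (t : R) (y : 'rV[R]_n) => u (rV_rcons y t)) @ F -->
    (cst l : 'rV[R]_n -> R)} ->
  \forall t \near F, forall y : 'rV[R]_n, `|l - u (rV_rcons y t)| < e.
Proof.
move=> FF e0 ul.
have := ul [set h : 'rV[R]_n -> R | forall y, `|l - h y| < e]; apply.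
apply/uniform_nbhs; exists [set xy | ball xy.1 e xy.2]; split.
  exact: entourage_ball (PosNum e0).
by move=> h hP y; have := hP y Logic.I; rewrite /= -ball_normE.
Qed.

Lemma uniform_limit_top (e : R) : 0 < e ->
  {uniform, (fun (t : R) (y : 'rV[R]_n) => u (rV_rcons y t)) @ +oo -->
    (cst 1 : 'rV[R]_n -> R)} ->
  exists M, forall x : 'rV[R]_n.+1, M < x 0 ord_max -> 1 - e <= u x.
Proof.
move=> e0 ul; have [M [_ MP]] := uniform_near _ e0 ul.
exists M => x /MP/(_ (rV_unrcons x).1); rewrite rcons_unrcons ltr_norml.
by move=> /andP[? ?]; lra.
Qed.

Lemma uniform_limit_bot (e : R) : 0 < e ->
  {uniform, (fun (t : R) (y : 'rV[R]_n) => u (rV_rcons y t)) @ -oo -->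
    (cst (-1) : 'rV[R]_n -> R)} ->
  exists M, forall x : 'rV[R]_n.+1, x 0 ord_max < M -> u x <= - 1 + e.
Proof.
move=> e0 ul; have [M [_ MP]] := uniform_near _ e0 ul.
exists M => x /MP/(_ (rV_unrcons x).1); rewrite rcons_unrcons ltr_norml.
by move=> /andP[? ?]; lra.
Qed.

End uniform_limits.

(* The dimension of the space is d = n.+1. *)
Theorem theorem1p6 (R : realType) (n : nat) (j : 'rV[R]_n.+1 -> R)
    (f : R -> R) (u : 'rV[R]_n.+1 -> R) :
  levy_density j ->
  condA1 j ->
  C1_fun f ->
  (0 < ereal_inf [set (derive1 f r)%:E | r in [set r : R | (1 <= `|r|)%R]])%E ->
  continuous u ->
  bounded_fun u ->
  viscosity_solution j [set: 'rV[R]_n.+1] u (fun x => f (u x)) ->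
  {uniform, (fun (t : R) (y : 'rV[R]_n) => u (rV_rcons y t)) @ +oo -->
    (cst 1 : 'rV[R]_n -> R)} ->
  {uniform, (fun (t : R) (y : 'rV[R]_n) => u (rV_rcons y t)) @ -oo -->
    (cst (-1) : 'rV[R]_n -> R)} ->
  exists u0 : R -> R,
    {homo u0 : s t / s < t} /\
    forall (y : 'rV[R]_n) (t : R), u (rV_rcons y t) = u0 t.
Proof.
move=> hj _ f1 finf cu [B0 [_ uB0]] [vsub vsup] top bot.
(* [bounded_fun] provides the bound only for constants strictly larger than B0. *)
pose B := `|B0| + 1.
have uB x : `|u x| <= B.
  by apply: uB0 => //; rewrite /B (le_lt_trans (ler_norm _))// ltrDl.
have Bp : 0 <= B by exact: le_trans (uB 0).
have cf : continuous f := derive_continuous (C1_is_derive f1).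
have [Lam Lam0 fLam] := C1_increment_le f1 Bp.
have [delta [c [delta0 delta1 c0 fc]]] := C1_strong_monotone f1 finf.
have [m1 m1P] : exists m, forall r, `|r| <= B -> `|f r| <= m.
  have BB : - B <= B by lra.
  have cnf : continuous (fun r => `|f r|).
    move=> r; apply: (@continuous_comp _ _ _ f (fun t : R => `|t|)); first exact: cf.
    exact: norm_continuous.
  have [m _ mP] := EVT_max BB (continuous_subspaceT cnf).
  by exists `|f m| => r; rewrite ler_norml => rB; apply: mP; rewrite in_itv.
(* A common bound of u and f(u), as [viscosity_approx] requires. *)
pose B' := B + `|m1|.
have ucf : continuous (fun x => f (u x)) by exact: continuous_compV.
have uB' x : `|u x| <= B' by rewrite (le_trans (uB x))// lerDl.
have fB' x : `|f (u x)| <= B'.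
  by rewrite (le_trans (m1P _ (uB x)))// (le_trans (ler_norm _))// lerDr.
have uf : approx j u (fun x => f (u x)).
  apply: (viscosity_approx hj cu ucf uB' fB').
    by move=> phi x; exact: (supersolution_touch hj vsup).
  by move=> phi x; exact: (subsolution_touch hj vsub).
have [A A0 uA] := approx_lipschitz hj uf.
have [M1 M1P] := uniform_limit_top delta0 top.
have [M2 M2P] := uniform_limit_bot delta0 bot.
(* The added 1 turns the strict inequalities of the limits into the large ones of the sliding
   argument. *)
pose M := `|M1| + `|M2| + 1.
have M0 : 0 <= M by rewrite !addr_ge0.
have Mtop (x : 'rV[R]_n.+1) : M <= x 0 ord_max -> 1 - delta <= u x.
  move=> xM; apply: M1P; rewrite (lt_le_trans _ xM)// /M.
  by have := ler_norm M1; have := normr_ge0 M2; lra.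
have Mbot (x : 'rV[R]_n.+1) : x 0 ord_max <= - M -> u x <= - 1 + delta.
  move=> xM; apply: M2P; rewrite (le_lt_trans xM)// /M.
  by have := ler_norm (- M2); rewrite normrN; have := normr_ge0 M1; lra.
exact: (slide_symmetry hj A0 Lam0 delta1 c0 M0 uf uB uA fLam fc Mtop Mbot).
Qed.
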